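(* Let $t$ be a nonzero rational parameter and let $q$ be a power of a prime coprime to $6$ such that the elliptic surface $\mathcal{E}_t$ has good reduction at $q$. Assume moreover that $S^2=\frac{t-1}{t}$ has solutions $S$ over $\mathbb{F}_q$. Then (for either choice of the sign $\pm$, the same in numerator and denominator) $$q^2\left(H_{q}\left(\tfrac{1}{6},\tfrac{5}{6};\tfrac{1}{4},\tfrac{3}{4}\,\Big|\,\tfrac{2(7 \pm 9S)^2}{(5 \pm 3S)^3}\right)\right)^2-q=-\frac{1}{q}+\frac{1}{q(q-1)}\sum_{m=0}^{q-2}g(4m)\,g(-m)^4\,\omega\left(\frac{1}{256t}\right)^m.$$
   Context: For a prime power $q$ fix a non-trivial additive character $\psi_q$ of $\mathbb{F}_q$ and a generator $\omega$ of the group of multiplicative characters $\mathbb{F}_q^\times\to\mathbb{C}^\times$; put $g(m)=\sum_{x\in\mathbb{F}_q^\times}\omega(x)^m\psi_q(x)$. For a parameter $u$, $$H_{q}\left(\tfrac{1}{6},\tfrac{5}{6};\tfrac{1}{4},\tfrac{3}{4}\,|\,u\right)=\frac{1}{1-q}\sum_{m=0}^{q-2}q^{-2+s(m)}g(6m)g(m)g(-4m)g(-3m)\,\omega\left(-\tfrac{2^2}{3^3}u\right)^m,$$ where $s(m)$ is the multiplicity of $e^{2\pi i m/(q-1)}$ as a root of $(x-1)^2(x+1)(x^2+x+1)$. These expressions do not depend on the choice of $\psi_q$. $\mathcal{E}_t$ denotes the relatively minimal non-singular projective elliptic surface over $\mathbb{P}^1_s$ whose generic fibre is $Y^2=X^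3+\frac14(s^2-1)^2X^2+\frac{s^2(s^2-1)^3}{64t}X$.
   Formalization: Assumes t≠1; takes good reduction of E_t to mean an integral equation whose singular fibres keep number and type, so t≢1 mod p (the identity fails by ±q if t=1 in F_q); assumes 7±9S and 5±3S nonzero in F_q, so that ω of the argument is defined. *)

(* Defs.v *)
From HB Require Import structures.
From mathcomp Require Import all_boot all_order all_algebra all_fingroup algC.
From mathcomp Require Import reals trigo.
From mathcomp.real_closed Require Import complex.

Set Implicit Arguments.
Unset Strict Implicit.
Unset Printing Implicit Defensive.

Import Order.TTheory GRing.Theory Num.Theory.

Local Open Scope ring_scope.
Local Open Scope complex_scope.

(* The field of complex numbers is R[i], with R : realType.                   *)

Section Characters.

Variables (R : realType) (F : finFieldType).

Definition additive_character (psi : F -> R[i]) : Prop :=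
  psi 0 = 1 /\ forall x y, psi (x + y) = psi x * psi y.

Definition nontrivial_additive_character (psi : F -> R[i]) : Prop :=
  additive_character psi /\ exists x, psi x != 1.

Definition mult_character (chi : {unit F} -> R[i]) : Prop :=
  chi 1%g = 1 /\ forall x y, chi (x * y)%g = chi x * chi y.

Definition char_generator (omega : {unit F} -> R[i]) : Prop :=
  mult_character omega /\
  forall chi, mult_character chi ->
    exists k : int, forall x, chi x = omega x ^ k.

(* The value of a character of F^* at an element of F.  The value 0 off F^*   *)
(* is a default: the theorem only evaluates at non-zero elements.             *)
Definition char_eval (omega : {unit F} -> R[i]) (x : F) : R[i] :=
  oapp omega 0 (insub x).

Definition gauss_sum (psi : F -> R[i]) (omega : {unit F} -> R[i])
    (m : int) : R[i] :=
  \sum_(x : {unit F}) omega x ^ m * psi (val x).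

(* exp (2 * pi * i * x) *)
Definition expi (x : R) : R[i] := cos (2 * pi * x) +i* sin (2 * pi * x).

Definition smult (m : nat) : nat :=
  mup (expi (m%:R / #|F|.-1%:R))
    (('X - 1) ^+ 2 * ('X + 1) * ('X^2 + 'X + 1)).

(* H_q(1/6, 5/6; 1/4, 3/4 | u) *)
Definition Hq (psi : F -> R[i]) (omega : {unit F} -> R[i]) (u : F) : R[i] :=
  let q : R[i] := #|F|%:R in
  let g := gauss_sum psi omega in
  (1 - q)^-1 *
  \sum_(0 <= m < #|F|.-1)
    q ^ (- 2%:Z + (smult m)%:Z)
    * g (6%:Z * m%:Z) * g m%:Z * g (- (4%:Z * m%:Z)) * g (- (3%:Z * m%:Z))
    * char_eval omega (- (2 ^+ 2 / 3 ^+ 3) * u) ^+ m.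

End Characters.

(* An elliptic surface over P^1_s is given by the Weierstrass equation        *)
(*    Y^2 = X^3 + a2(s) X^2 + a4(s) X                                         *)
(* of its generic fibre.  We only consider a2 of degree <= 4 and a4 of degree *)
(* <= 8 (elliptic K3 surfaces): then c4 and the discriminant are binary forms *)
(* of degrees 8 and 24 on P^1.                                                *)
Record weierstrass (K : nzRingType) :=
  Weierstrass { wa2 : {poly K}; wa4 : {poly K} }.

Definition map_weierstrass (K L : nzRingType) (f : K -> L)
    (E : weierstrass K) : weierstrass L :=
  Weierstrass (map_poly f (wa2 E)) (map_poly f (wa4 E)).

Definition wc4 (K : nzRingType) (E : weierstrass K) : {poly K} :=
  16%:R *: (wa2 E ^+ 2 - 3%:R *: wa4 E).

Definition wdisc (K : nzRingType) (E : weierstrass K) : {poly K} :=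
  16%:R *: (wa4 E ^+ 2 * (wa2 E ^+ 2 - 4%:R *: wa4 E)).

(* Kodaira's symbols; In_ n and Istar n stand for I_n and I_n^*.              *)
Inductive kodaira :=
  | In_ of nat | II | III | IV | Istar of nat | IVstar | IIIstar | IIstar.

(* Tate's algorithm in residue characteristic prime to 6, for an equation     *)
(* that is minimal at the point, in terms of v(c4) and of v(discriminant).    *)
(* The last line is reached for no minimal equation.                          *)
Definition kodaira_of (vc4 vdisc : nat) : kodaira :=
  if (vdisc == 0)%N then In_ 0
  else if (vc4 == 0)%N then In_ vdisc
  else if (vc4 == 2)%N && (6 <= vdisc)%N then Istar (vdisc - 6)%N
  else match vdisc with
       | 2 => II | 3 => III | 4 => IV | 6 => Istar 0
       | 8 => IVstar | 9 => IIIstar | 10 => IIstar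
       | _ => In_ 0
       end.

Section GeometricFibres.

Variable L : closedFieldType.

(* Points of P^1(L) are Some x and None, the point at infinity.  The order is *)
(* that of P as a binary form of degree d; the zero form gets an order larger *)
(* than that of any other form.                                               *)
Definition form_order (d : nat) (P : {poly L}) (x : option L) : nat :=
  if P == 0 then d.+1
  else match x with
       | Some a => mup a P
       | None => (d - (size P).-1)%N
       end.

Variable E : weierstrass L.

Definition singular_fibre (x : option L) : bool :=
  (0 < form_order 24 (wdisc E) x)%N.

Definition minimal_at (x : option L) : bool :=
  ~~ ((4 <= form_order 8 (wc4 E) x)%N && (12 <= form_order 24 (wdisc E) x)%N).

Definition fibre_type (x : option L) : kodaira :=
  kodaira_of (form_order 8 (wc4 E) x) (form_order 24 (wdisc E) x).

(* E is an elliptic surface whose equation is everywhere minimal and whose    *)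
(* singular fibres, listed without repetition, have the types ks.             *)
Definition has_fibre_configuration (ks : seq kodaira) : Prop :=
  [/\ wdisc E != 0, forall x, minimal_at x
    & exists xs : seq (option L),
        [/\ uniq xs, forall x, (x \in xs) = singular_fibre x
          & ks = [seq fibre_type x | x <- xs]]].

End GeometricFibres.

Definition integral_at (F : finFieldType) (P : {poly rat}) : Prop :=
  forall i, (denq P`_i)%:~R != 0 :> F.

(* Good reduction, at the characteristic (prime to 6) of F, of the relatively *)
(* minimal elliptic surface over Q with equation E: the equation is integral, *)
(* and over algebraic closures it has the same singular fibres as its         *)
(* reduction.  The surface is obtained from the Weierstrass one by resolving  *)
(* rational double points, which the singular fibres determine; so reducing   *)
(* the resolved surface gives the smooth surface of the reduced equation.     *)
(* Note that ratr : rat -> F is reduction on rationals whose denominator is   *)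
(* invertible in F.                                                           *)
Definition good_reduction (F : finFieldType) (E : weierstrass rat) : Prop :=
  [/\ integral_at F (wa2 E), integral_at F (wa4 E)
    & exists (L : closedFieldType) (iota : {rmorphism F -> L})
             (ks : seq kodaira),
        has_fibre_configuration
          (map_weierstrass (ratr : rat -> algC) E) ks /\
        has_fibre_configuration
          (map_weierstrass iota (map_weierstrass (ratr : rat -> F) E)) ks].

Definition Et (t : rat) : weierstrass rat :=
  Weierstrass (4%:R^-1 *: ('X^2 - 1) ^+ 2)
              ((64%:R * t)^-1 *: ('X^2 * ('X^2 - 1) ^+ 3)).

(* Main.v *)
(**
Let phi be the quadratic character and z = (1 - S)/2, so that
z (1 - z) = 1/(4 t).  The Hasse-Davenport relation for the exponent 2 and
g(m) g(-m) = +-q turn both Gauss sum expressions into quadratic character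
sums:  q H_q = -phi(3u) sum_w phi(c w^3 + w + 1) with c = -4u/27, and the
right-hand side is B = sum_{a,b} phi(a b (1 + a + b) (a b - z (1 - z))).
For the given u the cubic has a rational root, and its sum is
+- A with A = sum_x phi(x (x^2 - 2x + z)).

It remains to show the finite Clausen formula B = A^2 - q.  Slicing the square
along x = l y, and then along m = Q(l y)/Q(y) with Q(y) = y^2 - 2y + z, gives
  A^2 - q = sum_{l,n} phi((1 - z)(n + 1/n) + z (l + 1/l) - 2),
which depends on l and n only through l + 1/l and n + 1/n, and so is the sum
for a double plane branched along six lines.  The Cremona map
a = z (1 + al)/be, b = (1 - z)(1 + be)/al carries it to B.  The curves where
this map is undefined contribute the same to both sides exactly when
z <> 1/2, that is t <> 1 in F: when t reduces to 1, two I_1 fibres of the surface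
meet, so good reduction excludes this.
*)
Require Import Defs.
From HB Require Import structures.
From mathcomp Require Import all_boot all_order all_algebra all_fingroup algC.
From mathcomp Require Import cyclic.
From mathcomp Require Import ring lra.
From mathcomp Require Import reals trigo.
From mathcomp.real_closed Require Import complex.

Set Implicit Arguments.
Unset Strict Implicit.
Unset Printing Implicit Defensive.

Import Order.TTheory GRing.Theory Num.Theory.

Local Open Scope ring_scope.
Local Open Scope complex_scope.

Lemma natr4_neq0 (K : fieldType) : 2 != 0 :> K -> 4 != 0 :> K.
Proof. by move=> K2; rewrite (natrM _ 2 2) mulf_neq0. Qed.

(** * Quadratic character sums *)

Section QuadraticCharacter.

Variables (F : finFieldType) (C : fieldType) (phi : F -> C).

(** The last clause, a count of square roots, is what turns root counts into values of [phi] and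
    back. *)
Definition quadratic_character : Prop :=
  [/\ phi 0 = 0, {morph phi : x y / x * y},
      forall x, x != 0 -> phi x ^+ 2 = 1
    & forall x, \sum_y (y ^+ 2 == x)%:R = 1 + phi x].

Hypothesis phiP : quadratic_character.
Hypothesis F2 : 2 != 0 :> F.

Let phi0 : phi 0 = 0. Proof. by case: phiP. Qed.
Let phiM (x y : F) : phi (x * y) = phi x * phi y. Proof. by case: phiP. Qed.
Let phi_sq1 (x : F) : x != 0 -> phi x ^+ 2 = 1. Proof. by case: phiP => _ _ + _; apply. Qed.
Let count_sqrt (x : F) : \sum_y (y ^+ 2 == x)%:R = 1 + phi x. Proof. by case: phiP. Qed.

Lemma quad_char_sqr (x : F) : x != 0 -> phi (x ^+ 2) = 1.
Proof. by move=> x0; rewrite expr2 phiM -expr2 phi_sq1. Qed.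

Lemma quad_char_sqrM (x y : F) : x != 0 -> phi (x ^+ 2 * y) = phi y.
Proof. by move=> x0; rewrite phiM quad_char_sqr // mul1r. Qed.

Lemma quad_char1 : phi 1 = 1.
Proof. by rewrite -[1 in LHS](expr1n _ 2) quad_char_sqr ?oner_neq0. Qed.

Lemma quad_charV (x : F) : phi x^-1 = phi x.
Proof.
have [->|x0] := eqVneq x 0; first by rewrite invr0.
by rewrite -(@quad_char_sqrM x) // expr2 -mulrA mulfV // mulr1.
Qed.

(** Double counting of the pairs with y^2 = x: one order of summation gives #|F|, the other #|F|
    plus this sum. *)
Lemma sum_quad_char : \sum_x phi x = 0.
Proof.
have: \sum_(x : F) \sum_y ((y ^+ 2 == x)%:R : C) = #|F|%:R.
  rewrite exchange_big /= -sumr_const; apply: eq_bigr => y _.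
  by rewrite (bigD1 (y ^+ 2)) //= eqxx big1 ?addr0 // => x /negPf; rewrite eq_sym => ->.
rewrite (eq_bigr _ (fun x _ => count_sqrt x)) big_split /= sumr_const.
by rewrite -[RHS]addr0 => /addrI.
Qed.

Lemma sum_quad_char_affine (a b : F) : a != 0 -> \sum_x phi (a * x + b) = 0.
Proof.
move=> a0; rewrite -[RHS]sum_quad_char.
rewrite [RHS](reindex_inj (h := fun x => a * x + b)) // => x y /addIr.
exact: mulfI.
Qed.

Lemma sum_indicator (P : F -> C) x : \sum_y (y == x)%:R * P y = P x.
Proof.
rewrite (bigD1 x) //= eqxx mul1r big1 ?addr0 // => y /negPf ->.
by rewrite mul0r.
Qed.

(** For y <> 0 only m = x / y contributes. For y = 0 the condition does not involve m, and the sum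
    vanishes in agreement with phi(0) = 0. *)
Lemma sum_quad_char_ratio (x y : F) :
  \sum_m phi m * (x == m * y)%:R = phi (x * y).
Proof.
have [->|y0] := eqVneq y 0.
  rewrite mulr0 phi0; under eq_bigr do rewrite mulr0.
  by rewrite -mulr_suml sum_quad_char mul0r.
transitivity (\sum_m (m == x / y)%:R * phi m).
  apply: eq_bigr => m _; rewrite mulrC; congr ((nat_of_bool _)%:R * _).
  by apply/eqP/eqP => ->; rewrite ?mulfK ?mulfVK.
by rewrite sum_indicator phiM quad_charV phiM.
Qed.

(** Completing the square by means of a y + b. *)
Lemma count_quadratic_roots (a b c : F) : a != 0 ->
  \sum_y (a * y ^+ 2 + 2 * b * y + c == 0)%:R = 1 + phi (b ^+ 2 - a * c).
Proof.
move=> a0; rewrite -count_sqrt.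
rewrite [RHS](reindex_inj (h := fun y => a * y + b)) /=;
  last by move=> x y /addIr /(mulfI a0).
apply: eq_bigr => y _; congr (_%:R); rewrite -[in RHS]subr_eq0.
have -> : (a * y + b) ^+ 2 - (b ^+ 2 - a * c) = a * (a * y ^+ 2 + 2 * b * y + c) by ring.
by rewrite mulf_eq0 (negPf a0).
Qed.

(** Minus the trace of Frobenius of v^2 = x (x^2 - 2x + z) when that curve is smooth. *)
Definition elliptic_sum (z : F) : C := \sum_x phi (x * (x ^+ 2 - 2 * x + z)).

(* The correction q comes from the slice l = 1, where the ratio m is 1 for all y. *)
Lemma elliptic_sum_sqr (z : F) : z != 0 ->
  elliptic_sum z ^+ 2 = #|F|%:R +
    \sum_l \sum_m phi (l * m * ((m - l) ^+ 2 - z * (m - 1) * (m - l ^+ 2))).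
Proof.
move=> z0; pose Q (y : F) : F := y ^+ 2 - 2 * y + z.
have inner y : \sum_x phi (x * Q x) * phi (y * Q y) = \sum_l phi (l * (Q (l * y) * Q y)).
  have [->|y0] := eqVneq y 0.
    rewrite big1 => [|x _]; last by rewrite mul0r phi0 mulr0.
    under eq_bigr => l _ do rewrite mulr0 -expr2 /Q mulr0 subr0 expr0n add0r phiM.
    by rewrite -mulr_suml sum_quad_char mul0r.
  rewrite (reindex_inj (mulIf y0)) /=; apply: eq_bigr => l _.
  rewrite -[RHS](@quad_char_sqrM y) // -phiM; congr phi; ring.
(* Summed over l, the term - phi(l) disappears and the last one leaves #|F|. *)
have slice l : phi l * (\sum_y phi (Q (l * y) * Q y)) =
    \sum_m phi (l * m * ((m - l) ^+ 2 - z * (m - 1) * (m - l ^+ 2)))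
    - phi l + (l == 1)%:R * #|F|%:R.
  have [->|l0] := eqVneq l 0.
    rewrite eq_sym (negPf (oner_neq0 _)) mul0r addr0 phi0 mul0r subr0 big1 // => m _.
    by rewrite !mul0r phi0.
  have [->|l1] := eqVneq l 1.
    rewrite quad_char1 !mul1r.
    (* The summand phi(Q(y)^2) is 1 off the roots of Q, whose number is 1 + phi(1 - z). *)
    have -> : \sum_y phi (Q (1 * y) * Q y) = #|F|%:R - (1 + phi (1 - z)).
      have -> : 1 - z = (-1) ^+ 2 - 1 * z by ring.
      rewrite -count_quadratic_roots ?oner_neq0 // -sumr_const -sumrB.
      apply: eq_bigr => y _; rewrite !mul1r mulrN1 mulNr -/(Q y) -expr2.
      have [->|Qy] := eqVneq (Q y) 0; last by rewrite quad_char_sqr // subr0.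
      by rewrite expr0n phi0 subrr.
    (* For l = 1 the argument collapses to (1 - z) m (m - 1)^2. *)
    have -> : \sum_m phi (1 * m * ((m - 1) ^+ 2 - z * (m - 1) * (m - 1 ^+ 2))) =
      - phi (1 - z).
      rewrite (bigD1 1) //= subrr mulr0 mul0r subr0 expr0n mulr0 phi0 add0r.
      transitivity (\sum_(m | m != 1) phi m * phi (1 - z)).
        apply: eq_bigr => m m1; rewrite -phiM -[RHS](@quad_char_sqrM (m - 1)) ?subr_eq0 //.
        by congr phi; ring.
      have := sum_quad_char; rewrite (bigD1 1) //= quad_char1 -mulr_suml.
      by move=> /eqP; rewrite addrC addr_eq0 => /eqP ->; rewrite mulN1r.
    ring.
  rewrite mul0r addr0.
  have -> : \sum_y phi (Q (l * y) * Q y) =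
      \sum_m phi m * phi ((m - l) ^+ 2 - z * (m - 1) * (m - l ^+ 2)) - 1.
    under eq_bigr do rewrite -sum_quad_char_ratio.
    rewrite exchange_big /=.
    (* Q(l y) - m Q(y) = (l^2 - m) y^2 + 2 (m - l) y + z (1 - m). For m = l^2 this is linear with
       one root, whereas the discriminant formula counts two, because (l^2 - l)^2 is a non-zero
       square. *)
    have cnt m : \sum_y (Q (l * y) == m * Q y)%:R =
        1 + phi ((m - l) ^+ 2 - z * (m - 1) * (m - l ^+ 2)) - (m == l ^+ 2)%:R.
      have [->|ml] := eqVneq m (l ^+ 2).
        rewrite subrr mulr0 subr0.
        have nz : l ^+ 2 - l != 0.
          by rewrite expr2 -{3}(mulr1 l) -mulrBr mulf_neq0 ?subr_eq0.
        rewrite quad_char_sqr // addrK.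
        pose y0 := - (z * (1 - l ^+ 2)) / (2 * (l ^+ 2 - l)).
        rewrite (bigD1 y0) //= big1 => [|y yy0].
          rewrite addr0; suff -> : Q (l * y0) == l ^+ 2 * Q y0 by [].
          by rewrite /Q /y0; apply/eqP; field; rewrite nz.
        suff /negPf -> : Q (l * y) != l ^+ 2 * Q y by [].
        apply: contra yy0 => /eqP E; apply/eqP; rewrite /y0.
        have nz2 : 2 * (l ^+ 2 - l) != 0 by rewrite mulf_neq0.
        apply: (mulIf nz2); rewrite mulfVK //.
        apply/eqP; rewrite -subr_eq0.
        have -> : y * (2 * (l ^+ 2 - l)) - - (z * (1 - l ^+ 2)) = Q (l * y) - l ^+ 2 * Q y.
          by rewrite /Q; ring.
        by rewrite E subrr.
      have a0 : l ^+ 2 - m != 0 by rewrite subr_eq0 eq_sym.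
      rewrite subr0.
      have -> : (m - l) ^+ 2 - z * (m - 1) * (m - l ^+ 2) =
         (m - l) ^+ 2 - (l ^+ 2 - m) * (z * (1 - m)) by ring.
      rewrite -(count_quadratic_roots (m - l) (z * (1 - m)) a0); apply: eq_bigr => y _.
      rewrite -subr_eq0; congr ((_ == _)%:R); rewrite /Q; ring.
    under eq_bigr do rewrite -mulr_sumr cnt mulrBr mulrDr mulr1.
    rewrite big_split /= big_split /= sum_quad_char add0r sumrN; congr (_ - _).
    under eq_bigr do rewrite mulrC.
    by rewrite sum_indicator quad_char_sqr.
  rewrite mulrBr mulr1 mulr_sumr; congr (_ - _); apply: eq_bigr => m _.
  by rewrite -!phiM mulrA.
rewrite /elliptic_sum expr2 mulr_sumr.
under eq_bigr => y _.
  rewrite mulr_suml inner.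
  over.
rewrite exchange_big /=.
under eq_bigr => l _.
  under eq_bigr do rewrite phiM.
  rewrite -mulr_sumr slice.
  over.
rewrite !big_split /= sumrN sum_quad_char subr0 addrC; congr (_ + _).
exact: sum_indicator.
Qed.

(** The equation x + c / x = s is x^2 - s x + c = 0, which does not have the root 0. *)
Lemma sum_add_inv (f : F -> C) (c : F) : c != 0 ->
  \sum_(x | x != 0) f (x + c / x) = \sum_s (1 + phi (s ^+ 2 - 4 * c)) * f s.
Proof.
move=> c0.
transitivity (\sum_(x | x != 0) \sum_s (s == x + c / x)%:R * f s).
  by apply: eq_bigr => x _; rewrite sum_indicator.
rewrite exchange_big /=; apply: eq_bigr => s _; rewrite -mulr_suml; congr (_ * _).
have -> : s ^+ 2 - 4 * c = 2 ^+ 2 * ((- s / 2) ^+ 2 - 1 * c) by field.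
rewrite quad_char_sqrM // -count_quadratic_roots ?oner_neq0 //.
rewrite [RHS](bigD1 0) //= expr0n !mulr0 !add0r (negPf c0) add0r.
apply: eq_bigr => x x0; congr ((nat_of_bool _)%:R).
rewrite -(inj_eq (mulIf x0)) -subr_eq0 -[RHS]oppr_eq0; congr (_ == _).
by field; rewrite F2 x0.
Qed.

(** Putting m = l n and dropping a square leaves a linear form in s = n + 1/n and t = l + 1/l, whose
    fibres are counted by [sum_add_inv]. The sixth branch line is the line at infinity. *)
Lemma torus_sum_six_lines (z : F) : z != 0 -> 1 - z != 0 ->
  \sum_l \sum_m phi (l * m * ((m - l) ^+ 2 - z * (m - 1) * (m - l ^+ 2))) =
  \sum_a \sum_b phi (a * (1 + a) * (b * (1 + b)) * ((1 - z) * b + z * a)).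
Proof.
move=> z0 z1.
transitivity (\sum_(l | l != 0) \sum_(n | n != 0)
    phi ((1 - z) * (n + 1 / n) + z * (l + 1 / l) - 2)).
  rewrite (bigD1 0) //= big1 ?add0r => [|m _]; last by rewrite !mul0r phi0.
  apply: eq_bigr => l l0; rewrite (reindex_inj (mulfI l0)) (bigD1 0) //=.
  rewrite !mulr0 mul0r phi0 add0r; apply: eq_bigr => n n0.
  rewrite -[RHS](@quad_char_sqrM (l ^+ 2 * n)) ?mulf_neq0 ?expf_neq0 //.
  by congr phi; field; rewrite l0 n0.
under eq_bigr => l _.
  rewrite (sum_add_inv (fun s => phi ((1 - z) * s + z * (l + 1 / l) - 2))) ?oner_neq0 //.
  over.
rewrite (sum_add_inv (fun t => \sum_s (1 + phi (s ^+ 2 - 4 * 1)) *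
   phi ((1 - z) * s + z * t - 2))) ?oner_neq0 //.
transitivity (\sum_t \sum_s phi (t ^+ 2 - 4) * phi (s ^+ 2 - 4) *
   phi ((1 - z) * s + z * t - 2)).
  (* [col] removes the terms without the weight phi(s^2 - 4), and [row] those without phi(t^2 -
     4). *)
  have col t : \sum_s phi ((1 - z) * s + z * t - 2) = 0.
    by under eq_bigr do rewrite -addrA; exact: sum_quad_char_affine.
  have row s : \sum_t phi ((1 - z) * s + z * t - 2) = 0.
    by under eq_bigr do rewrite [_ + z * _]addrC -addrA; exact: sum_quad_char_affine.
  rewrite !mulr1.
  under eq_bigr => t _.
    under eq_bigr do rewrite mulrDl mul1r.
    rewrite big_split /= col add0r mulrDl mul1r mulr_sumr.
    under [X in _ + X]eq_bigr do rewrite mulrA.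
    over.
  rewrite big_split /= exchange_big /= big1 ?add0r // => s _.
  by rewrite -mulr_sumr row mulr0.
(* For t = 4 a + 2 one has t^2 - 4 = 16 a (1 + a); the linear form acquires a factor 4, and 16 * 16
   * 4 is the square of 2^5. *)
have inj4 : injective (fun a : F => 4 * a + 2).
  by move=> x y /addIr /(mulfI (natr4_neq0 F2)).
rewrite (reindex_inj inj4); apply: eq_bigr => a _.
rewrite (reindex_inj inj4); apply: eq_bigr => b _ /=.
rewrite -!phiM -[RHS](@quad_char_sqrM (2 ^+ 5)) ?expf_neq0 //.
by congr phi; ring.
Qed.

(** The Cremona map [f] restricts to a bijection from [P] to [Q] with inverse [g], and carries one
    summand to the other up to squares. The two complements contribute the same amount. *)
Lemma six_lines_sum_conic (z : F) : z != 0 -> 1 - z != 0 -> 2 * z - 1 != 0 ->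
  \sum_a \sum_b phi (a * (1 + a) * (b * (1 + b)) * ((1 - z) * b + z * a)) =
  \sum_a \sum_b phi (a * b * (1 + a + b) * (a * b - z * (1 - z))).
Proof.
move=> z0 z1 z2.
rewrite !pair_big /=.
pose h (p : F * F) :=
  phi (p.1 * (1 + p.1) * (p.2 * (1 + p.2)) * ((1 - z) * p.2 + z * p.1)).
pose k (p : F * F) := phi (p.1 * p.2 * (1 + p.1 + p.2) * (p.1 * p.2 - z * (1 - z))).
pose P (p : F * F) := [&& p.1 != 0, p.2 != 0 & 1 + p.1 + p.2 != 0].
pose Q (p : F * F) := [&& p.1 + z != 0, p.2 + (1 - z) != 0 & p.1 * p.2 - z * (1 - z) != 0].
rewrite -/(\sum_p h p) -/(\sum_p k p) (bigID P) [RHS](bigID Q) /=.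
(* The line 1 + a + b = 0 is contracted by the Cremona map. *)
have outside_h : \sum_(p | ~~ P p) h p = - phi (- z) - phi (z - 1).
  transitivity (\sum_p (p.2 == - 1 - p.1)%:R * h p).
    rewrite big_mkcond /=; apply: eq_bigr => -[a b] _; rewrite /P /h /=.
    have [->|a0] := eqVneq a 0; first by rewrite !mul0r phi0 mulr0.
    have [->|b0] := eqVneq b 0; first by rewrite mul0r mulr0 mul0r phi0 mulr0.
    rewrite negbK; have -> : (1 + a + b == 0) = (b == -1 - a).
      by rewrite -[RHS]subr_eq0; congr (_ == _); ring.
    by case: ifP; rewrite ?mul1r ?mul0r.
  rewrite -(pair_bigA _ (fun a b => (b == -1 - a)%:R * h (a, b))) /=.
  (* On b = -1 - a the argument is (a (1 + a))^2 times a linear form of slope 2 z - 1, non-zero by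
     hypothesis. The corrections come from a = 0 and a = -1, where the square vanishes. *)
  have line a : \sum_b (b == -1 - a)%:R * h (a, b) =
      phi ((2 * z - 1) * a + (z - 1)) - (a == -1)%:R * phi (- z) - (a == 0)%:R * phi (z -
        1).
    rewrite sum_indicator /h /=.
    have [->|a0] := eqVneq a 0.
      rewrite !mul0r phi0 mulr0 add0r eq_sym oppr_eq0 (negPf (oner_neq0 _)).
      by rewrite mul0r subr0 mul1r subrr.
    have [->|a1] := eqVneq a (-1).
      rewrite subrr mulr0 !mul0r phi0 mul1r subr0.
      by have -> : (2 * z - 1) * -1 + (z - 1) = - z; [ring|rewrite subrr].
    rewrite !mul0r !subr0 -[RHS](@quad_char_sqrM (a * (1 + a))).
      by congr phi; ring.
    by rewrite mulf_neq0 // addrC -(opprK 1) subr_eq0.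
  under eq_bigr do rewrite line.
  rewrite !big_split /= sum_quad_char_affine // !sumrN add0r.
  by rewrite !sum_indicator.
(* The lines a = -z and b = z - 1 are contracted by its inverse. *)
have outside_k : \sum_(p | ~~ Q p) k p = - phi (- z) - phi (z - 1).
  (* The points with a b = z (1 - z) contribute 0. The common point (-z, z - 1) of the two lines is
     among them, so counting it twice is harmless. *)
  transitivity (\sum_p ((p.1 == - z)%:R * k p + (p.2 == z - 1)%:R * k p)).
    rewrite big_mkcond /=; apply: eq_bigr => -[a b] _; rewrite /Q /k /=.
    have -> : (a + z == 0) = (a == - z) by rewrite addr_eq0.
    have -> : (b + (1 - z) == 0) = (b == z - 1) by rewrite addr_eq0 opprB.
    have [->|az] := eqVneq a (- z).
      have [->|bz] := eqVneq b (z - 1); last by rewrite mul1r mul0r addr0.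
      have -> : 1 - z + (z - 1) = 0 by ring.
      by rewrite mulr0 mul0r phi0 mulr0 addr0.
    have [->|bz] := eqVneq b (z - 1); first by rewrite mul1r mul0r add0r.
    rewrite !mul0r addr0.
    by have [->|//] := eqVneq (a * b - z * (1 - z)) 0; rewrite mulr0 phi0.
  rewrite big_split /= -(pair_bigA _ (fun a b => (a == - z)%:R * k (a, b))) /=.
  rewrite -(pair_bigA _ (fun a b => (b == z - 1)%:R * k (a, b))) /=.
  under eq_bigr do rewrite -mulr_sumr.
  rewrite (sum_indicator (fun a => \sum_b k (a, b))).
  under [X in _ + X]eq_bigr do rewrite (sum_indicator (fun b => k (_, b))).
  (* Along either line the argument is a coordinate times a square that vanishes at one value v
     only, so just the term phi(v) is missing from a full sum of [phi]. *)
  have tangent (u v : F) : u != 0 -> \sum_b phi (b * (u * (b - v)) ^+ 2) = - phi v.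
    move=> u0; have := sum_quad_char; rewrite (bigD1 v) //= addrC => /eqP.
    rewrite addr_eq0 => /eqP <-; rewrite (bigD1 v) //= subrr mulr0 expr0n mulr0 phi0 add0r.
    apply: eq_bigr => b bv; rewrite mulrC quad_char_sqrM // mulf_neq0 ?subr_eq0 //.
  rewrite -(tangent z (z - 1)) // -(tangent (1 - z) (- z)) // addrC.
  by congr (_ + _); apply: eq_bigr => b _; congr phi; rewrite /=; ring.
rewrite outside_h outside_k; congr (_ + _).
pose f (p : F * F) := (z * (1 + p.1) / p.2, (1 - z) * (1 + p.2) / p.1).
pose g (p : F * F) := let w := p.1 * p.2 - z * (1 - z) in
  ((1 - z) * (p.1 + z) / w, z * (p.2 + (1 - z)) / w).
(* Since 1/0 = 0, [f] has values also where a = 0 or b = 0. Such points fail g(f p) = p whenever f p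
   lies in [Q], because [g] has non-zero coordinates on [Q]. *)
rewrite [RHS](reindex_onto f g) /=.
  symmetry; apply: eq_big => -[a b].
    rewrite /P /Q /f /g /=; have [->|a0] := eqVneq a 0.
      rewrite invr0 !mulr0 ?mul0r sub0r !add0r.
      apply/negP => /andP[/and3P[u0 v0 w0]] /eqP[].
      by move/eqP; rewrite !mulf_eq0 invr_eq0 (negPf w0) (negPf z1) (negPf u0).
    have [->|b0] := eqVneq b 0.
      rewrite invr0 !mulr0 ?mul0r sub0r !add0r.
      apply/negP => /andP[/and3P[u0 v0 w0]] /eqP[] _.
      by move/eqP; rewrite !mulf_eq0 invr_eq0 (negPf w0) (negPf z0) (negPf v0).
    have -> : z * (1 + a) / b + z = z * (1 + a + b) / b by field.
    have -> : (1 - z) * (1 + b) / a + (1 - z) = (1 - z) * (1 + a + b) / a by field.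
    have -> : z * (1 + a) / b * ((1 - z) * (1 + b) / a) - z * (1 - z) =
       z * (1 - z) * (1 + a + b) / (a * b) by field; rewrite a0 b0.
    rewrite !mulf_eq0 !invr_eq0 !mulf_eq0 (negPf z0) (negPf z1) (negPf a0) (negPf b0) /=
      !orbF.
    case: eqVneq => //= ab; apply/eqP; congr (_, _); field.
      by rewrite ab z0 z1 a0 b0.
    by rewrite ab z0 z1 a0 b0.
  rewrite /P /Q /f /g /= => /andP[/and3P[u0 v0 w0]] /eqP[ga gb].
  have a0 : a != 0 by rewrite -ga !mulf_neq0 ?invr_eq0.
  have b0 : b != 0 by rewrite -gb !mulf_neq0 ?invr_eq0.
  have ab : 1 + a + b != 0.
    apply: contra w0 => /eqP ab0; apply/eqP.
    transitivity (z * (1 - z) * (1 + a + b) / (a * b)); first by field; rewrite a0 b0.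
    by rewrite ab0 mulr0 mul0r.
  rewrite /h /k /=.
  (* If (A, B) is the image of (a, b), then 1 + A + B = (1 + a + b) (z a + (1 - z) b) / (a b) and A
     B - z (1 - z) = z (1 - z) (1 + a + b) / (a b). *)
  rewrite -[RHS](@quad_char_sqrM (z * (1 - z) * (1 + a + b) / (a * b) ^+ 2)).
    by congr phi; field; rewrite a0 b0.
  by rewrite !mulf_neq0 // invr_eq0 expf_neq0 // mulf_neq0.
move=> -[a b] /and3P[/= u0 v0 w0]; rewrite /f /g /=.
by congr (_, _); field; rewrite w0 ?u0 ?v0 ?z0 ?z1.
Qed.

(** A finite-field counterpart of Clausen's expression of a 3F2 as the square of a 2F1. *)
Lemma elliptic_sum_Clausen (z : F) : z != 0 -> 1 - z != 0 -> 2 * z - 1 != 0 ->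
  \sum_a \sum_b phi (a * b * (1 + a + b) * (a * b - z * (1 - z))) =
  elliptic_sum z ^+ 2 - #|F|%:R.
Proof.
move=> z0 z1 z2.
by rewrite elliptic_sum_sqr // torus_sum_six_lines // six_lines_sum_conic // (addrC
  #|F|%:R) addrK.
Qed.

End QuadraticCharacter.

(* With f an additive character this is Salie's evaluation of a twisted
   Kloosterman sum.  For c = d^2 it follows from
   y + c / y - 2 d = (y - d)^2 / y, and for c a non-square from y -> c / y. *)
Lemma Salie_sum (F : finFieldType) (C : fieldType) (phi f : F -> C) (c : F) :
  quadratic_character phi -> 2 != 0 :> F -> 2 != 0 :> C -> c != 0 ->
  \sum_(y | y != 0) phi y * f (y + c / y) =
  \sum_v (v ^+ 2 == 4 * c)%:R * \sum_s phi (s - v) * f s.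
Proof.
move=> phiP F2 C2 c0; have [phi0 phiM phi1 count] := phiP.
have F4 := natr4_neq0 F2.
have [/existsP[d /eqP def_c]|nsq] := boolP [exists d, d ^+ 2 == c]; last first.
  have nosqrt v : v ^+ 2 == 4 * c = false.
    apply: contraNF nsq => /eqP v2; apply/existsP; exists (v / 2).
    by apply/eqP; rewrite expr_div_n v2; field.
  rewrite [RHS]big1 => [|v _]; last by rewrite nosqrt mul0r.
  have phic : phi c = -1.
    have /eqP : 1 + phi c = 0.
      rewrite -count big1 // => v _; case: eqP => // v2; case/existsP: nsq.
      by exists v; apply/eqP.
    by rewrite addrC addr_eq0 => /eqP.
  set L := LHS; suff /eqP : L = - L.
    by rewrite -addr_eq0 -mulr2n -mulr_natl mulf_eq0 (negPf C2) => /eqP.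
  rewrite {1}/L (reindex_onto (fun y => c / y) (fun y => c / y)) /=; last first.
    by move=> y y0; rewrite invf_div mulrCA divff ?mulr1.
  rewrite -sumrN; apply: eq_big => y.
    have [->|y0] := eqVneq y 0; first by rewrite invr0 mulr0 eqxx.
    by rewrite mulf_neq0 ?invr_eq0 //= invf_div mulrCA divff // mulr1 eqxx.
  move=> /andP[y0 _].
  have {}y0 : y != 0 by apply: contraNneq y0 => ->; rewrite invr0 mulr0.
  rewrite phiM phic (quad_charV phiP) mulN1r mulNr; congr (- (_ * f _)).
  by rewrite addrC invf_div mulrCA divff // mulr1.
have d0 : d != 0 by apply: contraNneq c0 => d0; rewrite -def_c d0 expr0n.
have -> : \sum_v (v ^+ 2 == 4 * c)%:R * (\sum_s phi (s - v) * f s) =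
    \sum_s phi (s - 2 * d) * f s + \sum_s phi (s + 2 * d) * f s.
  have eqv v : (v ^+ 2 == 4 * c)%:R = (v == 2 * d)%:R + (v == - (2 * d))%:R :> C.
    have -> : v ^+ 2 == 4 * c = (v == 2 * d) || (v == - (2 * d)).
      by rewrite -eqf_sqr -def_c; congr (_ == _); ring.
    have [->|] := eqVneq v (2 * d); last by rewrite add0r.
    suff /negPf -> : 2 * d != - (2 * d) by rewrite addr0.
    by rewrite -addr_eq0 -mulrDl -natrD mulf_neq0.
  under eq_bigr do rewrite eqv mulrDl.
  rewrite big_split /= !sum_indicator; congr (_ + _).
  by apply: eq_bigr => s _; rewrite opprK.
(* At y = d the square factor vanishes while phi(d) does not, hence the extra term. *)
have phi_y y : y != 0 -> phi y * f (y + c / y) =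
    phi (y + c / y - 2 * d) * f (y + c / y) + (y == d)%:R * (phi d * f (2 * d)).
  move=> y0; have sq : y + c / y - 2 * d = (1 / y * (y - d)) ^+ 2 * y.
    by rewrite -def_c; field; rewrite y0.
  have [yd|yd] := eqVneq y d.
    rewrite sq yd subrr mulr0 expr0n !mul0r phi0 mul0r add0r mul1r; congr (_ * f _).
    by rewrite -def_c; field; rewrite d0.
  rewrite mul0r addr0 sq (quad_char_sqrM phiP) //.
  by rewrite mulf_neq0 ?subr_eq0 // mul1r invr_eq0.
rewrite (eq_bigr _ phi_y) big_split /=.
rewrite (sum_add_inv phiP F2 (fun s => phi (s - 2 * d) * f s)) //.
have -> : \sum_(y | y != 0) (y == d)%:R * (phi d * f (2 * d)) = phi d * f (2 * d).
  by rewrite (bigD1 d) //= eqxx mul1r big1 ?addr0 // => y /andP[_ /negPf ->]; rewrite mul0r.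
under [X in X + _ = _]eq_bigr do rewrite mulrDl mul1r.
rewrite big_split /= -addrA; congr (_ + _).
(* The product phi(s^2 - 4 c) phi(s - 2 d) equals phi(s + 2 d) except at s = 2 d. The value phi(4 d)
   missing there is the extra term phi(d). *)
rewrite [RHS](bigD1 (2 * d)) //= (bigD1 (2 * d)) //= subrr phi0 mul0r mulr0 add0r addrC.
congr (_ + _).
  by have -> : 2 * d + 2 * d = 2 ^+ 2 * d; [ring|rewrite (quad_char_sqrM phiP)].
apply: eq_bigr => s sd.
have -> : s ^+ 2 - 4 * c = (s - 2 * d) * (s + 2 * d) by rewrite -def_c; ring.
rewrite mulrA -phiM -[phi (s + 2 * d)](quad_char_sqrM phiP _ (x := s - 2 * d)) ?subr_eq0 //.
by congr (phi _ * _); ring.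
Qed.

(** * Roots of unity *)

Section RootsOfUnity.

Variable R : realType.

Lemma expiD (x y : R) : expi (x + y) = expi x * expi y.
Proof.
rewrite /expi mulrDr cosD sinD; apply/eqP; rewrite eq_complex /= eqxx /=.
by apply/eqP; ring.
Qed.

Lemma expi_natmul (x : R) k : expi (x *+ k) = expi x ^+ k.
Proof.
elim: k => [|k IHk]; last by rewrite mulrS exprS expiD IHk.
by rewrite mulr0n expr0 /expi mulr0 cos0 sin0.
Qed.

Lemma expi1 : expi (1 : R) = 1.
Proof. by rewrite /expi mulr1 mulr_natl cos2pi sin2pi. Qed.

Lemma expi_neq1 (x : R) : 0 < x < 1 -> expi x != 1.
Proof.
move=> /andP[x0 x1]; rewrite /expi eq_complex /= -mulrA mulr_natl cos_mulr2n cos2sin2.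
have : 0 < sin (pi * x).
  by apply: sin_gt0_pi; rewrite mulr_gt0 ?pi_gt0 //= gtr_pMr ?pi_gt0.
move=> s0; apply/negP => /andP[/eqP c _]; have : 0 < sin (pi * x) ^+ 2 by rewrite exprn_gt0.
lra.
Qed.

Lemma expi_primitive_root n : (0 < n)%N -> n.-primitive_root (expi n%:R^-1 : R[i]).
Proof.
move=> n0; apply/andP; split=> //; apply/forallP => i; apply/eqP.
have nR : 0 < n%:R :> R by rewrite ltr0n.
rewrite unity_rootE -expi_natmul -[_ *+ _]mulr_natl.
have := ltn_ord i; rewrite leq_eqVlt => /orP[/eqP ->|lt_i].
  by rewrite (mulfV (lt0r_neq0 nR)) expi1 !eqxx.
rewrite (ltn_eqF lt_i); apply/negbTE/expi_neq1.
by rewrite mulr_gt0 ?invr_gt0 //= ltr_pdivrMr // mul1r ltr_nat.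
Qed.

End RootsOfUnity.

(** Regrouping as (X - 1) (X^3 - 1) (X + 1), with X^3 - 1 separable because 3 <> 0, makes every
    multiplicity a sum of indicators. *)
Lemma mup_hypergeometric (K : fieldType) (w : K) : 2 != 0 :> K -> 3 != 0 :> K ->
  mup w (('X - 1) ^+ 2 * ('X + 1) * ('X^2 + 'X + 1)) =
    ((w == 1%R) + (w ^+ 3 == 1%R) + (w == (-1)%R))%N.
Proof.
move=> K2 K3.
have -> : ('X - 1) ^+ 2 * ('X + 1) * ('X^2 + 'X + 1) =
    ('X - 1%:P) ^+ 1 * ('X^3 - 1) * ('X - (-1)%:P) ^+ 1 :> {poly K}.
  by rewrite polyCN !expr1; ring.
have X3 : 'X^3 - 1 != 0 :> {poly K} by rewrite -size_poly_eq0 size_XnsubC.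
have X1 a : 'X - a%:P != 0 :> {poly K} by rewrite polyXsubC_eq0.
rewrite !mupM ?mulf_neq0 ?expr1 //.
rewrite -['X - 1%:P]expr1 -['X - (-1)%:P]expr1 !mup_XsubCX ![_ == w]eq_sym 
  !(fun b => erefl : (if b then 1 else 0) = nat_of_bool b)%N.
congr (_ + _ + _)%N.
have [w3|w3] := eqVneq (w ^+ 3) 1; last first.
  by rewrite mupNroot // /root !hornerE subr_eq0.
have -> : 'X^3 - 1 = ('X - w%:P) ^+ 1 * ('X^2 + w *: 'X + (w ^+ 2)%:P).
  by rewrite -(polyC1 K) -w3 expr1 -mul_polyC !rmorphXn /=; ring.
rewrite mupMl ?mup_XsubCX ?eqxx // /root !hornerE.
have -> : w ^+ 2 + w * w + w ^+ 2 = 3 * w ^+ 2 by ring.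
rewrite mulf_neq0 // expf_neq0 //; apply: contraTneq (oner_neq0 K) => w0.
by rewrite -w3 w0 expr0n eqxx.
Qed.

(** * Multiplicative characters *)

Lemma card_finField_pred_gt0 (F : finFieldType) : (0 < #|F|.-1)%N.
Proof. by rewrite -subn1 subn_gt0 card_finNzRing_gt1. Qed.

Section MultiplicativeCharacters.

Variables (R : realType) (F : finFieldType) (omega : {unit F} -> R[i]).
Hypothesis omegaP : char_generator omega.

Local Notation n := #|F|.-1.

(* Unlike [char_eval omega x ^ m], this is 0 at x = 0 also when m = 0. *)
Definition mchar (m : int) (x : F) : R[i] :=
  if x == 0 then 0 else char_eval omega x ^ m.

Let n_gt0 : (0 < n)%N. Proof. exact: card_finField_pred_gt0. Qed.

Let omega1 : omega 1%g = 1. Proof. by case: omegaP => -[]. Qed.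
Let omegaM x y : omega (x * y)%g = omega x * omega y. Proof. by case: omegaP => -[]. Qed.

Lemma omegaX u k : omega (u ^+ k)%g = omega u ^+ k.
Proof.
elim: k => [|k IHk]; first by rewrite expg0 omega1.
by rewrite expgS omegaM IHk exprS.
Qed.

Lemma omega_expn u : omega u ^+ n = 1.
Proof.
by rewrite -omegaX -card_finField_unit expg_cardG ?in_setT.
Qed.

Lemma omega_neq0 u : omega u != 0.
Proof.
apply: contra_eq_neq (omega_expn u) => ->.
by rewrite expr0n gtn_eqF // eq_sym oner_eq0.
Qed.

Lemma unit_generator : exists2 u : {unit F}, #[u]%g = n & forall v, exists k,
  v == (u ^+ k)%g.
Proof.
have /cyclicP[u def_u] := field_unit_group_cyclic [set: {unit F}].
exists u => [|v]; first by rewrite /order -def_u card_finField_unit.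
by have /cycleP[k ->] : v \in <[u]>%g; [rewrite -def_u in_setT | exists k].
Qed.

(** A generator of the character group is faithful: if it is trivial at u then so is every
    character, in particular the one that sends a generator of the units to a primitive n-th root of
    unity. *)
Lemma omega_eq1 u : (omega u == 1) = (u == 1%g).
Proof.
apply/eqP/eqP => [ou|->]; last exact: omega1.
have [g og gen] := unit_generator.
have prim := expi_primitive_root R n_gt0.
pose log v := xchoose (gen v).
have logP v : v = (g ^+ log v)%g by apply/eqP/(xchooseP (gen v)).
pose chi v : R[i] := expi n%:R^-1 ^+ log v.
have chiP : mult_character chi.
  split=> [|x y].
    rewrite /chi -(prim_expr_mod prim) -og.
    have /eqP := logP 1%g; rewrite eq_sym -order_dvdn => /eqP ->.
    by rewrite expr0.
  rewrite /chi -exprD; apply/eqP; rewrite (eq_prim_root_expr prim) -og -eq_expg_mod_order.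
  by rewrite expgD -!logP.
have [k chiE] := omegaP.2 _ chiP.
have : chi u == 1 by rewrite chiE ou exp1rz.
rewrite /chi -(prim_order_dvd prim) -og order_dvdn => /eqP.
by rewrite -logP.
Qed.

Lemma char_eval_val u : char_eval omega (val u) = omega u.
Proof. by rewrite /char_eval valK. Qed.

Lemma unit_val (x : F) : x != 0 -> {u : {unit F} | x = val u}.
Proof. by rewrite -unitfE => Ux; exists (Sub x Ux); rewrite SubK. Qed.

Lemma val_unit_neq0 (u : {unit F}) : val u != 0.
Proof. by rewrite -unitfE; exact: valP. Qed.

Lemma char_eval0 : char_eval omega 0 = 0.
Proof. by rewrite /char_eval insubF //= unitr0. Qed.

Lemma char_evalM (x y : F) : char_eval omega (x * y) =
  char_eval omega x * char_eval omega y.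
Proof.
have [->|/unit_val[u ->]] := eqVneq x 0; first by rewrite mul0r char_eval0 mul0r.
have [->|/unit_val[v ->]] := eqVneq y 0; first by rewrite mulr0 char_eval0 mulr0.
by rewrite -[val u * val v]/(val (u * v)%g) !char_eval_val.
Qed.

Lemma char_eval1 : char_eval omega 1 = 1.
Proof. by rewrite -[1 in LHS]/(val (1%g : {unit F})) char_eval_val. Qed.

Lemma char_eval_eq1 (x : F) : (char_eval omega x == 1) = (x == 1).
Proof.
have [->|/unit_val[u ->]] := eqVneq x 0.
  by rewrite char_eval0 ![0 == 1]eq_sym !oner_eq0.
by rewrite char_eval_val omega_eq1 -val_eqE.
Qed.

Lemma char_eval_neq0 (x : F) : x != 0 -> char_eval omega x != 0.
Proof. by move=> /unit_val[u ->]; rewrite char_eval_val omega_neq0. Qed.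

Lemma char_eval_expn (x : F) : x != 0 -> char_eval omega x ^+ n = 1.
Proof. by move=> /unit_val[u ->]; rewrite char_eval_val omega_expn. Qed.

Lemma char_evalV (x : F) : char_eval omega x^-1 = (char_eval omega x)^-1.
Proof.
have [->|x0] := eqVneq x 0; first by rewrite invr0 char_eval0 invr0.
apply: (mulfI (char_eval_neq0 x0)).
by rewrite -char_evalM !mulfV ?char_eval_neq0 ?char_eval1.
Qed.

Lemma char_evalX (x : F) k : char_eval omega (x ^+ k) = char_eval omega x ^+ k.
Proof.
by elim: k => [|k IHk]; rewrite ?expr0 ?char_eval1 // !exprS char_evalM IHk.
Qed.

Lemma char_evalXz (x : F) (k : int) : char_eval omega (x ^ k) = char_eval omega x ^ k.
Proof. by case: k => k; rewrite ?NegzE -?exprnN -?exprnP ?char_evalV char_evalX. Qed.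

Lemma mchar0 m : mchar m 0 = 0.
Proof. by rewrite /mchar eqxx. Qed.

Lemma mcharM m : {morph mchar m : x y / x * y}.
Proof.
move=> x y; rewrite /mchar mulf_eq0.
have [_|x0] := eqVneq x 0; first by rewrite mul0r.
have [_|y0] := eqVneq y 0; first by rewrite mulr0.
by rewrite /= char_evalM exprzMl ?unitfE ?char_eval_neq0.
Qed.

Lemma mchar1 m : mchar m 1 = 1.
Proof. by rewrite /mchar oner_eq0 char_eval1 exp1rz. Qed.

Lemma mcharD m k (x : F) : mchar (m + k) x = mchar m x * mchar k x.
Proof.
rewrite /mchar; have [_|x0] := eqVneq x 0; first by rewrite mul0r.
by rewrite expfzDr ?char_eval_neq0.
Qed.

Lemma mchar_mull (a m : int) (x : F) : x != 0 -> mchar (a * m) x = mchar m (x ^ a).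
Proof.
move=> x0; rewrite /mchar expfz_eq0 (negPf x0) andbF char_evalXz.
by rewrite exprz_exp.
Qed.

Lemma mchar_muln m (x : F) : x != 0 -> mchar (m * n%:Z) x = 1.
Proof.
move=> x0; rewrite /mchar (negPf x0) mulrC -exprz_exp -exprnP char_eval_expn //.
exact: exp1rz.
Qed.

Lemma mchar_neq0 m (x : F) : x != 0 -> mchar m x != 0.
Proof. by move=> x0; rewrite /mchar (negPf x0) expfz_neq0 ?char_eval_neq0. Qed.

Lemma mcharN m (x : F) : mchar (- m) x = mchar m x^-1.
Proof.
have [->|x0] := eqVneq x 0; first by rewrite invr0 !mchar0.
by rewrite -mulN1r mchar_mull // -exprN1.
Qed.

(** A geometric sum whose ratio is 1 only for x = 1, by faithfulness of [omega]. *)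
Lemma sum_mchar_exponent (x : F) :
  \sum_(0 <= m < n) mchar m%:Z x = n%:R * (x == 1)%:R.
Proof.
rewrite /mchar; have [->|x0] := eqVneq x 0.
  by rewrite big1_eq eq_sym oner_eq0 mulr0.
under eq_bigr do rewrite -exprnP.
rewrite big_mkord; have [->|x1] := eqVneq x 1.
  under eq_bigr do rewrite char_eval1 expr1n.
  by rewrite sumr_const card_ord mulr1.
have y1 : char_eval omega x - 1 != 0 by rewrite subr_eq0 char_eval_eq1.
by apply: (mulfI y1); rewrite -subrX1 char_eval_expn // subrr !mulr0.
Qed.

Lemma sum_mchar m : \sum_x mchar m x = n%:R * (n %| `|m|)%:R.
Proof.
have [g og gen] := unit_generator.
have [/dvdnP[k mE]|ndvd] := boolP (n %| `|m|)%N.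
  have one x : x != 0 -> mchar m x = 1.
    by move=> x0; rewrite [m]intEsign mE PoszM mulrA mchar_muln.
  rewrite (bigD1 0) //= mchar0 add0r (eq_bigr (fun=> 1)) // sumr_const mulr1.
  by congr (_%:R); rewrite cardC1.
rewrite mulr0; have gm : mchar m (val g) != 1.
  rewrite /mchar (negPf (val_unit_neq0 _)) char_eval_val.
  apply: contra ndvd => /eqP gm; rewrite -og order_dvdn -omega_eq1 omegaX.
  case: m gm => k; first by move=> <-.
  by rewrite NegzE -exprnN abszN => /(congr1 GRing.inv); rewrite invrK invr1 => <-.
have : mchar m (val g) * (\sum_x mchar m x) = \sum_x mchar m x.
  rewrite mulr_sumr [RHS](reindex_inj (mulfI (val_unit_neq0 g))) /=.
  by apply: eq_bigr => x _; rewrite mcharM.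
by move/eqP; rewrite -subr_eq0 -{2}[\sum_x _]mul1r -mulrBl mulf_eq0 subr_eq0 (negPf gm)
  => /eqP.
Qed.

(** The value at a generator of the units is -1, since otherwise its order would divide n/2.
    Non-squares are the odd powers of that generator. *)
Lemma mchar_half_quadratic : 2 != 0 :> F -> ~~ odd n ->
  quadratic_character (mchar (n./2)%:Z).
Proof.
move=> F2 n_even; have n2 : n = (n./2 * 2)%N by rewrite muln2 even_halfK.
have sq1 x : x != 0 -> mchar (n./2)%:Z x ^+ 2 = 1.
  by move=> x0; rewrite /mchar (negPf x0) -exprnP -exprM -n2 char_eval_expn.
split=> // [||x]; [exact: mchar0|exact: mcharM|].
have [->|x0] := eqVneq x 0.
  rewrite mchar0 addr0 (bigD1 0) //= expr0n eqxx big1 ?addr0 // => y /negPf y0.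
  by rewrite sqrf_eq0 y0.
have [/existsP[s /eqP def_x]|nsq] := boolP [exists s, s ^+ 2 == x].
  have s0 : s != 0 by apply: contraNneq x0 => s0; rewrite -def_x s0 expr0n.
  rewrite -[in RHS]def_x [in RHS]expr2 mcharM -expr2 sq1 // -def_x.
  have sN : - s != s by rewrite eq_sym -addr_eq0 -mulr2n -mulr_natl mulf_neq0.
  rewrite (bigD1 s) //= eqxx (bigD1 (- s)) //= sqrrN eqxx big1 ?addr0 // => y /andP[y1 y2].
  by rewrite eqf_sqr (negPf y1) (negPf y2).
rewrite big1 => [|y _]; last by case: eqP nsq => // yx /existsP[]; exists y; apply/eqP.
have [g og gen] := unit_generator.
have phig : mchar (n./2)%:Z (val g) = -1.
  have /eqP := sq1 _ (val_unit_neq0 g); rewrite -[X in _ == X](expr1n _ 2) eqf_sqr.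
  case/orP => /eqP //; rewrite /mchar (negPf (val_unit_neq0 _)) char_eval_val -exprnP
    -omegaX.
  move/eqP; rewrite omega_eq1 -order_dvdn og => /dvdn_leq.
  have : (0 < n./2)%N by rewrite -(ltn_pmul2r (isT : 0 < 2)%N) -n2 mul0n.
  by move=> h0 /(_ h0); rewrite {1}n2 muln2 -addnn -{3}[n./2]addn0 leq_add2l leqNgt h0.
have [u xu] := unit_val x0; have [k /eqP uk] := gen u.
have xg : x = val g ^+ k by rewrite xu uk; elim: k {uk} => [|k IHk];
  rewrite ?expg0 // expgS exprS -IHk.
have mcharXn j : mchar (n./2)%:Z (val g ^+ j) = (-1) ^+ j.
  by elim: j => [|j IHj]; rewrite ?mchar1 // !exprS mcharM phig IHj.
rewrite xg mcharXn -signr_odd; case: (boolP (odd k)) => [_|kev];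
  first by rewrite expr1 subrr.
case/existsP: nsq; exists (val g ^+ k./2).
by rewrite xg -exprM muln2 even_halfK.
Qed.

End MultiplicativeCharacters.

(** * Gauss sums *)

Lemma natr_coprime_card (F : finFieldType) m : coprime #|F| m -> m%:R != 0 :> F.
Proof.
move=> co; apply/negP => /eqP m0.
(* Translation by 1 permutes F and changes the sum of all elements by #|F|. *)
have card0 : #|F|%:R = 0 :> F.
  have : \sum_(x : F) x = \sum_(x : F) x + #|F|%:R.
    by rewrite {1}(reindex_inj (addIr 1)) big_split /= sumr_const.
  by rewrite -{1}[\sum_x x]addr0 => /addrI.
have [|km kn E _] := egcdnP #|F| (_ : 0 < m)%N.
  by rewrite lt0n; apply: contraTneq co => ->;
    rewrite /coprime gcdn0 gtn_eqF ?card_finNzRing_gt1.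
move: E; rewrite gcdnC (eqP co) => /(congr1 (fun k : nat => k%:R : F)).
rewrite natrD !natrM m0 card0 !mulr0 add0r => /eqP.
by rewrite eq_sym oner_eq0.
Qed.

Section GaussSums.

Variables (R : realType) (F : finFieldType).
Variables (psi : F -> R[i]) (omega : {unit F} -> R[i]).
Hypothesis psiP : nontrivial_additive_character psi.
Hypothesis omegaP : char_generator omega.
Hypothesis F2 : 2 != 0 :> F.
Hypothesis n_even : ~~ odd #|F|.-1.

Local Notation n := #|F|.-1.
Local Notation q := (#|F|%:R : R[i]).
Local Notation h := (n./2)%:Z.
Local Notation chi := (mchar omega).
Local Notation phi := (chi h).
Local Notation g := (gauss_sum psi omega).

Let phiP : quadratic_character phi := mchar_half_quadratic omegaP F2 n_even.

Let mcharM := mcharM omegaP.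
Let mchar1 := mchar1 omegaP.
Let mcharD := mcharD omegaP.
Let mchar_mull := mchar_mull omegaP.
Let mchar_muln := mchar_muln omegaP.
Let mcharN := mcharN omegaP.
Let mchar_neq0 := mchar_neq0 omegaP.

Let psi0 : psi 0 = 1. Proof. by case: psiP => -[]. Qed.
Let psiD x y : psi (x + y) = psi x * psi y. Proof. by case: psiP => -[]. Qed.

Let n_gt0 : (0 < n)%N. Proof. exact: card_finField_pred_gt0. Qed.

Let n_half : n = (n./2 * 2)%N. Proof. by rewrite muln2 even_halfK. Qed.

Let h_gt0 : (0 < n./2)%N.
Proof. by rewrite -(ltn_pmul2r (isT : 0 < 2)%N) -n_half mul0n. Qed.

Let h_lt : (n./2 < n)%N.
Proof. by rewrite [ltnRHS]n_half muln2 -addnn -[ltnLHS]addn0 ltn_add2l. Qed.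

Let qE : q = n%:R + 1. Proof. by rewrite natr1 prednK // (ltn_trans _ (card_finNzRing_gt1
  F)). Qed.

Let q_neq0 : q != 0.
Proof. by rewrite pnatr_eq0 -lt0n (ltn_trans _ (card_finNzRing_gt1 F)). Qed.

Lemma gauss_sumE m : g m = \sum_x chi m x * psi x.
Proof.
rewrite (bigD1 0) //= mchar0 mul0r add0r (reindex_omap (val : {unit F} -> F) insub) /=.
  rewrite /gauss_sum; apply: eq_big => [u|u _].
    by rewrite val_unit_neq0 valK eqxx.
  by rewrite /mchar (negPf (val_unit_neq0 _)) char_eval_val.
by move=> x; rewrite -unitfE => Ux; rewrite insubT.
Qed.

Lemma sum_additive_character (s : F) : \sum_x psi (x * s) = q * (s == 0)%:R.
Proof.
have [->|s0] := eqVneq s 0.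
  under eq_bigr do rewrite mulr0 psi0.
  by rewrite sumr_const mulr1.
have <- : \sum_x psi x = \sum_x psi (x * s) by rewrite (reindex_inj (mulIf s0)).
rewrite mulr0.
have [_ [x0 psix0]] := psiP.
have : psi x0 * (\sum_x psi x) = \sum_x psi x.
  rewrite mulr_sumr [RHS](reindex_inj (addrI x0)) /=.
  by apply: eq_bigr => x _; rewrite psiD.
by move/eqP; rewrite -subr_eq0 -{2}[\sum_x _]mul1r -mulrBl mulf_eq0 subr_eq0 (negPf
  psix0) => /eqP.
Qed.

Lemma sum_additive_character_neq0 (s : F) :
  \sum_(x | x != 0) psi (x * s) = q * (s == 0)%:R - 1.
Proof.
rewrite -sum_additive_character [X in _ = X - _](bigD1 0) //= mul0r psi0.
by rewrite addrAC subrr add0r.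
Qed.

Lemma quadratic_gauss_sum_scale (s : F) : \sum_x phi x * psi (x * s) = phi s * g h.
Proof.
have [->|s0] := eqVneq s 0.
  rewrite mchar0 mul0r; under eq_bigr do rewrite mulr0 psi0 mulr1.
  exact: sum_quad_char.
rewrite gauss_sumE mulr_sumr [RHS](reindex_inj (mulIf s0)) /=.
apply: eq_bigr => x _; rewrite [x * s]mulrC mcharM !mulrA -(mcharM _ s s) -expr2.
by rewrite (quad_char_sqr phiP) // mul1r mulrC.
Qed.

Lemma gauss_sum_period m k : g (m + k * n%:Z) = g m.
Proof.
rewrite !gauss_sumE; apply: eq_bigr => x _; congr (_ * _).
have [->|x0] := eqVneq x 0; first by rewrite !mchar0.
by rewrite mcharD mchar_muln // mulr1.
Qed.

Lemma gauss_sum0 : g 0 = -1.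
Proof.
rewrite gauss_sumE (bigD1 0) //= mchar0 mul0r add0r.
transitivity (\sum_(x | x != 0) psi (x * 1)).
  by apply: eq_bigr => x x0; rewrite mulr1 -(mul0r n%:Z) mchar_muln // mul1r.
by rewrite sum_additive_character_neq0 oner_eq0 mulr0 sub0r.
Qed.

(** With x = w y the sum over all y would isolate w = -1. Leaving out y = 0 subtracts the full sum
    of the character, which is n when the character is trivial. *)
Lemma gauss_sum_mulN m : g m * g (- m) = q * chi m (-1) - n%:R * (n %| `|m|)%:R.
Proof.
rewrite mulrC !gauss_sumE mulr_suml.
under eq_bigr do rewrite mulr_sumr.
transitivity (\sum_w \sum_(y | y != 0) chi m w * psi (y * (w + 1))).
  rewrite exchange_big [RHS]exchange_big /=.
  rewrite exchange_big (bigD1 0) //= big1 ?add0r => [|x _];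
    last by rewrite mcharN invr0 mchar0 !mul0r.
  apply: eq_bigr => y y0; rewrite (reindex_inj (mulIf y0)) /=.
  apply: eq_bigr => w _; rewrite mcharN mulrACA -mcharM -psiD.
  by rewrite mulrCA mulVf // mulr1 mulrDr mulr1 addrC [y * w]mulrC.
under eq_bigr do rewrite -mulr_sumr sum_additive_character_neq0 mulrBr mulr1.
rewrite big_split /= sumrN sum_mchar //; congr (_ - _).
under eq_bigr do rewrite addr_eq0 mulrCA [chi _ _ * _]mulrC.
by rewrite -mulr_sumr sum_indicator.
Qed.

Lemma quadratic_gauss_sum_sqr : g h ^+ 2 = q * phi (-1).
Proof.
have -> : g h ^+ 2 = g h * g (- h).
  rewrite -(gauss_sum_period (- h) 1) mul1r expr2; congr (_ * g _).
  by rewrite [X in _ + X%:Z]n_half muln2 -addnn PoszD addrA addNr add0r.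
by rewrite gauss_sum_mulN absz_nat gtnNdvd // mulr0 subr0.
Qed.

Lemma quadratic_gauss_sum_neq0 : g h != 0.
Proof.
rewrite -sqrf_eq0 quadratic_gauss_sum_sqr mulf_neq0 // mchar_neq0 //.
by rewrite oppr_eq0 oner_eq0.
Qed.

(* The Mellin transform of [Salie_sum]; no exponent is exceptional. *)
Lemma Hasse_Davenport2 k : g k * g (k + h) * chi k 4 = g (2 * k) * g h.
Proof.
have F4 := natr4_neq0 F2.
have Salie c : c != 0 -> \sum_(y | y != 0) phi y * psi (y + c / y) =
    \sum_v (v ^+ 2 == 4 * c)%:R * (psi v * g h).
  move=> c0; rewrite (Salie_sum psi phiP) // ?pnatr_eq0 //.
  apply: eq_bigr => v _; congr (_ * _); rewrite gauss_sumE mulr_sumr.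
  rewrite (reindex_inj (addIr v)) /=; apply: eq_bigr => s _.
  rewrite addrK psiD; ring.
rewrite [g k]gauss_sumE [g (k + h)]gauss_sumE.
(* Here c is the product of the two summation variables of g(k) and g(k + h). *)
transitivity (\sum_c chi k c * (\sum_(y | y != 0) phi y * psi (y + c / y)) * chi k 4).
  rewrite -mulr_suml; congr (_ * _).
  under [RHS]eq_bigr do rewrite mulr_sumr.
  rewrite [RHS]exchange_big /= mulrC mulr_suml (bigD1 0) //= mchar0 !mul0r add0r.
  apply: eq_bigr => y y0; rewrite mulr_sumr [RHS](reindex_inj (mulIf y0)) /=.
  apply: eq_bigr => x _; rewrite mulfK // mcharD psiD mcharM; ring.
(* The condition v^2 = 4 c is solved for c, so that the value of chi^k at 4 c = v^2 becomes that of
   chi^(2k) at v. *)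
transitivity (\sum_c \sum_v (c == v ^+ 2 / 4)%:R * (chi k (4 * c) * psi v * g h)).
  apply: eq_bigr => c _; have [->|c0] := eqVneq c 0.
    rewrite mchar0 !mul0r big1 // => v _.
    by rewrite !mulr0 mchar0 !mul0r mulr0.
  rewrite Salie // mulrAC mulr_sumr; apply: eq_bigr => v _.
  rewrite mcharM [chi k 4 * _]mulrC mulrCA -!mulrA; congr ((nat_of_bool _)%:R * _).
  by rewrite mulrA -expr2; apply/eqP/eqP => [->|->];
    [rewrite mulrAC divff ?mul1r | rewrite mulrCA divff ?mulr1].
rewrite exchange_big /= [g (2 * k)]gauss_sumE mulr_suml; apply: eq_bigr => v _.
rewrite (sum_indicator (fun c => chi k (4 * c) * psi v * g h)) mulrCA divff // mulr1.
have [->|v0] := eqVneq v 0; first by rewrite expr0n !mchar0.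
by rewrite mchar_mull.
Qed.

(** * From sums of Gauss sums to quadratic character sums *)

Let F4 : 4 != 0 :> F. Proof. exact: natr4_neq0. Qed.

Let mchar_lin (a b m : int) (x : F) : chi (a * m + b) x = chi m (x ^ a) * chi b x.
Proof.
have [->|x0] := eqVneq x 0; first by rewrite !mchar0 mulr0.
by rewrite mcharD mchar_mull.
Qed.

(** This isolates the dependence on m, so that orthogonality over m applies to products of Gauss
    sums. *)
Lemma gauss_sum_linear_quadratic (a m : int) :
  g (a * m + h) = \sum_x chi m (x ^ a) * (phi x * psi x).
Proof.
by rewrite gauss_sumE //; apply: eq_bigr => x _; rewrite mchar_lin mulrA.
Qed.

(** Orthogonality over m forces y = c x^3 / z^2. With z = w x, the argument of [psi] is x (1 + w + c
    / w^2), and the sum over x is a quadratic Gauss sum. Replacing w by 1/w gives the cubic; the - 1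
    accounts for the absent w = 0. *)
Lemma sum_gauss_elliptic (c : F) : c != 0 ->
  \sum_(0 <= m < n) g (3%:Z * m%:Z + h) * g (- 2%:Z * m%:Z + h) * g (- 1%:Z * m%:Z + h) *
    chi m c =
  n%:R * (g h * (phi c * (\sum_w phi (c * w ^+ 3 + w + 1) - 1))).
Proof.
move=> c0.
pose W (x z y : F) := phi x * psi x * (phi z * psi z) * (phi y * psi y).
transitivity (\sum_x \sum_z \sum_y \sum_(0 <= m < n) chi m (c * x ^+ 3 / z ^+ 2 / y) *
  W x z y).
  under [RHS]eq_bigr do (under eq_bigr do rewrite exchange_big; rewrite exchange_big).
  rewrite [RHS]exchange_big; apply: eq_bigr => m _ /=.
  rewrite !gauss_sum_linear_quadratic !mulr_suml; apply: eq_bigr => x _.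
  rewrite [RHS]exchange_big mulr_sumr mulr_suml; apply: eq_bigr => y _ /=.
  rewrite mulr_sumr !mulr_suml; apply: eq_bigr => z _.
  rewrite -exprnP -!exprnN expr1 /W !mcharM; ring.
transitivity (\sum_x \sum_z n%:R * W x z (c * x ^+ 3 / z ^+ 2)).
  apply: eq_bigr => x _; apply: eq_bigr => z _.
  have [->|x0] := eqVneq x 0.
    by rewrite {2}/W mchar0 !mul0r mulr0 big1 // => y _; rewrite big1 // => m _;
      rewrite /W mchar0 !mul0r mulr0.
  have [->|z0] := eqVneq z 0.
    by rewrite {2}/W mchar0 !(mul0r, mulr0) big1 // => y _; rewrite big1 // => m _;
      rewrite /W mchar0 !(mul0r, mulr0).
  under eq_bigr => y _.
    rewrite -mulr_suml sum_mchar_exponent // -mulrA.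
    have -> : (c * x ^+ 3 / z ^+ 2 / y == 1) = (y == c * x ^+ 3 / z ^+ 2).
      have [->|y0] := eqVneq y 0.
        rewrite invr0 mulr0 ![0 == _]eq_sym oner_eq0; apply/esym/negbTE.
        by rewrite !mulf_neq0 ?invr_eq0 ?expf_neq0.
      by rewrite -(inj_eq (mulIf y0)) mulfVK // mul1r eq_sym.
    over.
  by rewrite -mulr_sumr sum_indicator.
under eq_bigr do rewrite -mulr_sumr.
rewrite -mulr_sumr; congr (_ * _).
transitivity (\sum_(x | x != 0) \sum_w phi (c * w) * (phi x * psi (x * (1 + w +
  c / w ^+ 2)))).
  rewrite (bigD1 0) //= big1 ?add0r => [|z _]; last by rewrite /W mchar0 !mul0r.
  apply: eq_bigr => x x0; rewrite (reindex_inj (mulIf x0)) /=; apply: eq_bigr => w _.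
  have [->|w0] := eqVneq w 0; first by rewrite /W !(mul0r, mulr0, mchar0).
  have -> : W x (w * x) (c * x ^+ 3 / (w * x) ^+ 2) =
    phi (x * (w * x) * (c * x ^+ 3 / (w * x) ^+ 2)) * psi (x + w * x + c * x ^+ 3 / (w *
      x) ^+ 2).
    by rewrite /W !psiD (mcharM _ (x * (w * x))) (mcharM _ x); ring.
  rewrite [RHS]mulrA -mcharM; congr (_ * psi _).
    rewrite -[RHS](quad_char_sqrM phiP _ (x := x / w)) ?mulf_neq0 ?invr_eq0 //.
    by congr (mchar _ _ _); field; rewrite x0 w0.
  by field; rewrite x0 w0.
transitivity (\sum_w phi (c * w) * (phi (1 + w + c / w ^+ 2) * g h)).
  rewrite exchange_big /=; apply: eq_bigr => w _; rewrite -mulr_sumr; congr (_ * _).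
  by rewrite -quadratic_gauss_sum_scale // [RHS](bigD1 0) //= mchar0 mul0r add0r.
have -> : \sum_w phi (c * w ^+ 3 + w + 1) - 1 = \sum_(w | w != 0) phi (c * w ^+ 3 + w + 1).
  by rewrite (bigD1 0) //= expr0n mulr0 !add0r mchar1 addrAC subrr add0r.
rewrite (bigD1 0) //= mulr0 mchar0 mul0r add0r.
rewrite (reindex_onto (fun w => w^-1) (fun w => w^-1)) /=; last by move=> w _;
  rewrite invrK.
rewrite !mulr_sumr; apply: eq_big => [w|w w0]; first by rewrite invr_eq0 invrK eqxx andbT.
have {}w0 : w != 0 by case/andP: w0; rewrite invr_eq0.
rewrite mulrA -mcharM mulrC; congr (_ * _); rewrite -mcharM.
rewrite -[RHS](quad_char_sqrM phiP _ (x := w^-1)) ?invr_eq0 //.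
by congr (mchar _ _ _); rewrite exprVn invrK; field.
Qed.

(** Orthogonality over m eliminates the variable x of g(m + h). Scaling the variables a, b, c of
    g(-m)^3 by y makes the argument of [psi] equal to y times a form linear in b. The sum over y
    then forces that form to vanish, which determines phi(b). *)
Lemma sum_gauss_K3 (k : F) : k != 0 ->
  \sum_(0 <= m < n) g (- m%:Z) ^+ 3 * g (m%:Z + h) * g (2%:Z * m%:Z + h) * chi m k =
  n%:R * (q * \sum_a \sum_b phi (k * a * b) * phi (- (1 + a + b) * (a * b / k + 1))).
Proof.
move=> k0.
pose W (a b c x y : F) := psi a * psi b * psi c * (phi x * psi x) * (phi y * psi y).
pose X (a b c y : F) := a * b * c / (k * y ^+ 2).
transitivity (\sum_a \sum_y \sum_c \sum_b \sum_x \sum_(0 <= m < n)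
    chi m (k * x * y ^+ 2 / (a * b * c)) * W a b c x y).
  transitivity (\sum_(0 <= m < n) g (- m%:Z) * g (1%:Z * m%:Z + h) * g (- m%:Z) * g (- m%:Z)
      * g (2%:Z * m%:Z + h) * chi m k).
    by apply: eq_bigr => m _; rewrite mul1r; ring.
  have E m : g (- m%:Z) = \sum_a chi m a^-1 * psi a.
    by rewrite gauss_sumE //; apply: eq_bigr => a _; rewrite mcharN.
  under eq_bigr => m _.
    rewrite E !gauss_sum_linear_quadratic // !mulr_suml.
    under eq_bigr => a _.
      rewrite mulr_sumr mulr_suml; under eq_bigr => y _.
        rewrite mulr_sumr !mulr_suml; under eq_bigr => c _.
          rewrite mulr_sumr !mulr_suml; under eq_bigr => b _.
            rewrite mulr_sumr !mulr_suml.
            over.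
          over.
        over.
      over.
    over.
  rewrite exchange_big /=; apply: eq_bigr => a _.
  rewrite exchange_big /=; apply: eq_bigr => y _.
  rewrite exchange_big /=; apply: eq_bigr => c _.
  rewrite exchange_big /=; apply: eq_bigr => b _.
  rewrite exchange_big /=; apply: eq_bigr => x _; apply: eq_bigr => m _.
  rewrite -!exprnP expr1 !invfM /W !mcharM; ring.
transitivity (\sum_a \sum_y \sum_c \sum_b n%:R * W a b c (X a b c y) y).
  apply: eq_bigr => a _; apply: eq_bigr => y _; apply: eq_bigr => c _;
    apply: eq_bigr => b _.
  under eq_bigr do rewrite -mulr_suml sum_mchar_exponent // -mulrA.
  rewrite -mulr_sumr; congr (_ * _).
  (* If one of a, b, c, y is 0 then, as 1/0 = 0, both sides vanish. *)
  have [Z|NZ] := boolP ((a * b * c) * y == 0).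
    rewrite big1 => [|x _].
      suff -> : X a b c y = 0 by rewrite /W mchar0 !(mul0r, mulr0).
      move: Z; rewrite mulf_eq0 /X => /orP[] /eqP ->; first by rewrite mul0r.
      by rewrite expr0n mulr0 invr0 mulr0.
    suff -> : k * x * y ^+ 2 / (a * b * c) = 0 by rewrite eq_sym oner_eq0 mul0r.
    move: Z; rewrite mulf_eq0 => /orP[] /eqP ->; first by rewrite invr0 mulr0.
    by rewrite expr0n mulr0 mul0r.
  move: NZ; rewrite mulf_eq0 => /norP[abc0 y0].
  rewrite -[RHS](sum_indicator (fun x => W a b c x y)); apply: eq_bigr => x _.
  congr ((nat_of_bool _)%:R * _).
  rewrite -(inj_eq (mulIf abc0)) mulfVK // mul1r.
  have ky : k * y ^+ 2 != 0 by rewrite mulf_neq0 ?expf_neq0.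
  rewrite -[RHS](inj_eq (mulIf ky)) /X mulfVK //; congr (_ == _); ring.
under eq_bigr do (under eq_bigr do (under eq_bigr do rewrite -mulr_sumr;
  rewrite -mulr_sumr);
  rewrite -mulr_sumr).
rewrite -mulr_sumr; congr (_ * _).
transitivity (\sum_a \sum_c \sum_b \sum_(y | y != 0)
    phi (k * a * c) * phi b * psi (y * (1 + a + c + b * (a * c / k + 1)))).
  rewrite exchange_big /=.
  transitivity (\sum_(y | y != 0) \sum_a \sum_c \sum_b
    phi (k * a * c) * phi b * psi (y * (1 + a + c + b * (a * c / k + 1)))); last first.
    rewrite exchange_big /=; apply: eq_bigr => a _.
    rewrite exchange_big /=; apply: eq_bigr => c _.
    by rewrite exchange_big.
  rewrite (bigD1 0) //= big1 ?add0r => [|a _]; last first.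
    by rewrite big1 // => c _; rewrite big1 // => b _; rewrite /W mchar0 !(mul0r, mulr0).
  apply: eq_bigr => y y0.
  rewrite (reindex_inj (mulIf y0)); apply: eq_bigr => a _ /=.
  rewrite (reindex_inj (mulIf y0)); apply: eq_bigr => c _ /=.
  rewrite (reindex_inj (mulIf y0)); apply: eq_bigr => b _ /=.
  transitivity (phi (X (a * y) (b * y) (c * y) y * y) *
      psi (a * y + b * y + c * y + X (a * y) (b * y) (c * y) y + y)).
    by rewrite /W mcharM !psiD; ring.
  rewrite -mcharM; congr (_ * psi _).
    rewrite -[LHS](quad_char_sqrM phiP _ (x := k / y)) ?mulf_neq0 ?invr_eq0 //.
    by congr (mchar _ _ _); rewrite /X; field; rewrite k0 y0.
  by rewrite /X; field; rewrite k0 y0.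
rewrite mulr_sumr; apply: eq_bigr => a _; rewrite mulr_sumr; apply: eq_bigr => c _.
(* The second term, due to the exclusion of y = 0, is a multiple of the sum of [phi] and
   disappears. *)
transitivity (\sum_b (q * (phi (k * a * c) * (phi b * (1 + a + c + b * (a * c / k +
  1) == 0)%:R))
    - phi (k * a * c) * phi b)).
  apply: eq_bigr => b _; rewrite -mulr_sumr sum_additive_character_neq0 //; ring.
rewrite big_split /= sumrN -!mulr_sumr (sum_quad_char phiP) mulr0 subr0.
congr (_ * (_ * _)).
rewrite -sum_quad_char_ratio //; apply: eq_bigr => b _; congr (_ * (nat_of_bool _)%:R).
by rewrite addrC addr_eq0 eq_sym.
Qed.

Let opp1_neq0 : (-1 : F) != 0. Proof. by rewrite oppr_eq0 oner_eq0. Qed.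

Lemma gauss_sum_mulN_card m :
  q ^+ (n %| `|m|)%N * (g m * g (- m)) = q * chi m (-1).
Proof.
rewrite gauss_sum_mulN //; case: (boolP (n %| `|m|)%N) => [|_]; last first.
  by rewrite mulr0 subr0 mul1r.
move=> /dvdnP[k mE].
have -> : chi m (-1) = 1 by rewrite [m]intEsign mE PoszM mulrA mchar_muln.
by rewrite !mulr1 expr1 qE addrAC subrr add0r mulr1.
Qed.

(* The powers of q compensate g(k) g(-k) = 1 instead of +-q when n divides k. *)
Lemma gauss_sum_product m :
  q ^+ ((n %| `|m|) + (n %| `|(3%:Z * m)%R|))%N *
    (g (6%:Z * m) * g m * g (- (4%:Z * m)) * g (- (3%:Z * m))) * g h ^+ 3 =
  q ^+ 2 * (g (3%:Z * m + h) * g (- 2%:Z * m + h) * g (- 1%:Z * m + h)).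
Proof.
have m6 : 6%:Z * m = 2 * (3%:Z * m) by ring.
have m4 : - (4%:Z * m) = 2 * (- 2%:Z * m) by ring.
have m2 : - 2%:Z * m = 2 * (- 1%:Z * m) by ring.
have m1 : - 1%:Z * m = - m by ring.
(* Three duplications, for 6 m, -4 m and -2 m, use up the factor g(h)^3. *)
have /esym h6 := Hasse_Davenport2 (3%:Z * m).
have /esym h4 := Hasse_Davenport2 (- 2%:Z * m).
have /esym h2 := Hasse_Davenport2 (- 1%:Z * m).
rewrite -m6 in h6; rewrite -m4 in h4; rewrite -m2 in h2.
(* The factors at 4 cancel because 3 - 2 - 1 = 0. *)
have chi4 : chi (3%:Z * m) 4 * chi (- 2%:Z * m) 4 * chi (- 1%:Z * m) 4 = 1.
  rewrite -!mcharD (_ : _ + _ = 0 * n%:Z) ?mchar_muln //; ring.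
have chi1 : chi m (-1) * chi (3%:Z * m) (-1) = 1.
  by rewrite mchar_mull // -exprnP -mcharM -exprS -[X in _ ^+ X]/(2 *
    2)%N exprM sqrrN !expr1n mchar1.
have p1 := gauss_sum_mulN_card m; have p3 := gauss_sum_mulN_card (3%:Z * m).
rewrite -m1 in p1.
set G := g h in h6 h4 h2 *.
transitivity (q ^+ ((n %| `|m|) + (n %| `|(3%:Z * m)%R|))%N *
    (g (6%:Z * m) * G * g m * (g (- (4%:Z * m)) * G) * g (- (3%:Z * m))) * G);
      first by ring.
rewrite h6 h4.
transitivity (q ^+ (n %| `|m|)%N * q ^+ (n %| `|(3%:Z * m)%R|)%N * (g (3%:Z * m) *
  g (3%:Z * m + h) * chi (3%:Z * m) 4 *
   g m * ((g (- 2%:Z * m) * G) * g (- 2%:Z * m + h) * chi (- 2%:Z * m) 4) * g (- (3%:Z *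
     m)))).
  rewrite exprD; ring.
rewrite h2.
transitivity ((q ^+ (n %| `|m|)%N * (g m * g (- 1%:Z * m))) *
  (q ^+ (n %| `|(3%:Z * m)%R|)%N * (g (3%:Z * m) * g (- (3%:Z * m)))) *
  (g (3%:Z * m + h) * g (- 2%:Z * m + h) * g (- 1%:Z * m + h)) *
  (chi (3%:Z * m) 4 * chi (- 2%:Z * m) 4 * chi (- 1%:Z * m) 4)); first by ring.
rewrite p1 p3 chi4 mulr1; congr (_ * _).
transitivity (q ^+ 2 * (chi m (-1) * chi (3%:Z * m) (-1))); first by ring.
by rewrite chi1 mulr1.
Qed.

Lemma smultE m : (m < n)%N ->
  smult R F m = ((n %| m) + (n %| 3 * m) + (m == n./2))%N.
Proof.
move=> m_lt; have prim := expi_primitive_root R n_gt0.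
rewrite /smult mup_hypergeometric ?pnatr_eq0 //.
have -> : expi (m%:R / n%:R) = expi n%:R^-1 ^+ m :> R[i].
  by rewrite -expi_natmul mulr_natl.
rewrite -exprM !(prim_order_dvd prim) [(m * 3)%N]mulnC.
have -> : -1 = expi n%:R^-1 ^+ n./2 :> R[i].
  have /eqP : (expi n%:R^-1 ^+ n./2) ^+ 2 = 1 :> R[i].
    by rewrite -exprM -n_half prim_expr_order.
  rewrite -[X in _ == X](expr1n _ 2) eqf_sqr => /orP[/eqP E|/eqP -> //].
  have : (n %| n./2)%N by rewrite (prim_order_dvd prim) E.
  by rewrite gtnNdvd.
by rewrite (eq_prim_root_expr prim) !modn_small.
Qed.

Hypothesis F3 : 3 != 0 :> F.

(** Minus the trace of Frobenius of v^2 = c w^3 + w + 1 when that curve is smooth. *)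
Definition trinomial_sum (c : F) : R[i] := \sum_w phi (c * w ^+ 3 + w + 1).

(** Squaring removes the sign in q H = - phi(-c) [trinomial_sum c]. *)
Lemma Hq_trinomial (u : F) : u != 0 ->
  q ^+ 2 * Hq psi omega u ^+ 2 = trinomial_sum (- (2 ^+ 2 / 3 ^+ 3) * u) ^+ 2.
Proof.
move=> u0; set c := - (2 ^+ 2 / 3 ^+ 3) * u.
have c0 : c != 0 by rewrite !mulf_neq0 ?oppr_eq0 ?mulf_neq0 ?invr_eq0 ?expf_neq0.
have G0 := quadratic_gauss_sum_neq0.
pose T (m : nat) := g (3%:Z * m%:Z + h) * g (- 2%:Z * m%:Z + h) * g (- 1%:Z * m%:Z + h).
have term m : (m < n)%N -> q ^ (- 2%:Z + (smult R F m)%:Z)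
    * g (6%:Z * m%:Z) * g m%:Z * g (- (4%:Z * m%:Z)) * g (- (3%:Z * m%:Z)) =
    (1 + (m == n./2)%:R * n%:R) * (T m / g h ^+ 3).
  move=> mn; rewrite smultE // expfzDr // -exprnN -exprnP [(_ + (m == _))%N]addnC exprD.
  have -> : q ^+ (m == n./2) = 1 + (m == n./2)%:R * n%:R.
    by case: eqP => _; rewrite ?mul0r ?addr0 // mul1r addrC expr1 qE.
  apply: (mulIf (expf_neq0 3 G0)); rewrite -[RHS]mulrA mulfVK ?expf_neq0 //.
  have := gauss_sum_product m; rewrite -PoszM !absz_nat => E.
  apply: (mulfI (expf_neq0 2 q_neq0)).
  rewrite [RHS]mulrCA -E; field.
  by rewrite q_neq0.
(* The root -1 gives the term m = n/2 an additional factor q = 1 + n. Its surplus n g(h) phi(c)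
   restores the term w = 0 subtracted in [sum_gauss_elliptic]. *)
have Th : T n./2 = g h.
  have gh : g (- 1%:Z * h) = g h.
    rewrite -(gauss_sum_period _ 1); congr (g _).
    rewrite [X in 1 * X%:Z]n_half muln2 -addnn PoszD; ring.
  have g0 k : g (k * n%:Z) = -1.
    by rewrite -[k * _]add0r gauss_sum_period // gauss_sum0.
  rewrite /T.
  have -> : 3%:Z * h + h = 2 * n%:Z by rewrite [n in RHS]n_half PoszM; ring.
  have -> : - 1%:Z * h + h = 0 * n%:Z by ring.
  have -> : - 2%:Z * h + h = - 1%:Z * h by ring.
  by rewrite !g0 gh; ring.
have -> : Hq psi omega u = - (phi c * trinomial_sum c / g h ^+ 2).
  rewrite /Hq -/c.
  have -> : \sum_(0 <= m < n) q ^ (- 2%:Z + (smult R F m)%:Z)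
    * g (6%:Z * m%:Z) * g m%:Z * g (- (4%:Z * m%:Z)) * g (- (3%:Z * m%:Z))
    * char_eval omega c ^+ m =
    (g h ^+ 3)^-1 * (\sum_(0 <= m < n) T m * chi m c) +
    (g h ^+ 3)^-1 * (n%:R * \sum_(0 <= m < n) (m == n./2)%:R * (T m * chi m c)).
    rewrite !mulr_sumr -big_split /=; apply: eq_big_nat => m /andP[_ mn].
    by rewrite term // /mchar (negPf c0) -exprnP; ring.
  rewrite sum_gauss_elliptic // -/(trinomial_sum c).
  rewrite [\sum_(0 <= m < n) (m == _)%:R * _]big_mkord.
  rewrite (bigD1 (Ordinal h_lt)) //= eqxx big1 ?addr0 => [|i]; last first.
    by rewrite -val_eqE /= => /negPf ->; rewrite mul0r.
  rewrite mul1r Th.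
  have -> : 1 - q = - n%:R by rewrite qE; ring.
  field.
  by rewrite G0 pnatr_eq0 -lt0n n_gt0.
rewrite sqrrN expr_div_n exprMn.
have -> : phi c ^+ 2 = 1 by case: phiP => _ _ -> .
have -> : (g h ^+ 2) ^+ 2 = q ^+ 2.
  rewrite quadratic_gauss_sum_sqr // exprMn.
  by have -> : phi (-1) ^+ 2 = 1; [case: phiP => _ _ ->|rewrite mulr1].
by rewrite mul1r mulrCA divff ?mulr1 // expf_neq0.
Qed.

(** The cubic has the rational root -3 (5 + 3 S) / (7 + 9 S). Moving it to 0 gives e x (x^2 - 2x +
    z), and squaring removes the twist phi(e). *)
Lemma trinomial_sum_elliptic (S : F) : 7 + 9 * S != 0 -> 5 + 3 * S != 0 ->
  trinomial_sum (- (2 ^+ 2 / 3 ^+ 3) * (2 * (7 + 9 * S) ^+ 2 / (5 + 3 * S) ^+ 3)) ^+ 2 =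
  elliptic_sum phi ((1 - S) / 2) ^+ 2.
Proof.
move=> S7 S5; pose e := - 3 ^+ 3 / (7 + 9 * S).
(* The cubic c w^3 + w + 1 vanishes at the image of x = 0 under [aff]. *)
pose aff x : F := 3 / 2 * (5 + 3 * S) / (7 + 9 * S) * (3 * x - 2).
have aff_inj : injective aff.
  have slope : 3 / 2 * (5 + 3 * S) / (7 + 9 * S) != 0 by rewrite !mulf_neq0 ?invr_eq0.
  by move=> x y /(mulfI slope) /addIr /(mulfI F3).
have -> : trinomial_sum (- (2 ^+ 2 / 3 ^+ 3) * (2 * (7 + 9 * S) ^+ 2 / (5 + 3 * S) ^+ 3)) =
    phi e * elliptic_sum phi ((1 - S) / 2).
  rewrite /trinomial_sum /elliptic_sum mulr_sumr (reindex_inj aff_inj) /=.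
  apply: eq_bigr => x _; rewrite -mcharM; congr (mchar _ _ _).
  by rewrite /aff /e; field; rewrite F2 S7 S5 (natrM _ 3 9) (natrM _ 3 3) !mulf_neq0.
rewrite exprMn; have -> : phi e ^+ 2 = 1; last by rewrite mul1r.
by case: phiP => _ _ -> //; rewrite mulf_neq0 ?oppr_eq0 ?invr_eq0 ?expf_neq0.
Qed.

(** Duplicating g(4m) twice produces g(m), which is paired with one g(-m). The exceptional value of
    that pair at m = 0 adds n to the sum and thereby cancels -1/q. *)
Lemma hypergeometric_K3 (t : F) : t != 0 ->
  - q^-1 + (q * (q - 1))^-1 * \sum_(0 <= m < n)
        g (4%:Z * m%:Z) * g (- m%:Z) ^+ 4 * char_eval omega (256%:R * t)^-1 ^+ m =
  \sum_a \sum_b phi (a * b * (1 + a + b) * (a * b - (4 * t)^-1)).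
Proof.
move=> t0; pose k : F := - (4 * t)^-1.
have k0 : k != 0 by rewrite oppr_eq0 invr_eq0 mulf_neq0.
have G0 := quadratic_gauss_sum_neq0.
have n0 : n%:R != 0 :> R[i] by rewrite pnatr_eq0 -lt0n.
have t256 : 256%:R * t != 0.
  by rewrite mulf_neq0 // (natrM _ 4 64) (natrM _ 4 16) (natrM _ 4 4) !mulf_neq0.
have -> : \sum_(0 <= m < n) g (4%:Z * m%:Z) * g (- m%:Z) ^+ 4 * char_eval omega (256%:R *
  t)^-1 ^+ m =
   (g h ^+ 2)^-1 * (q * \sum_(0 <= m < n) g (- m%:Z) ^+ 3 * g (m%:Z + h) * g (2%:Z *
     m%:Z + h) * chi m k)
   + n%:R.
  have -> : n%:R = \sum_(0 <= m < n) n%:R * (m == 0%N)%:R :> R[i].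
    rewrite big_mkord (bigD1 (Ordinal n_gt0)) //= mulr1 big1 ?addr0 // => i.
    by rewrite -val_eqE /= => /negPf ->; rewrite mulr0.
  rewrite !mulr_sumr -big_split /=; apply: eq_big_nat => m /andP[_ mn].
  have m4 : 4%:Z * m%:Z = 2 * (2 * m%:Z) by ring.
  have h4 := Hasse_Davenport2 (2 * m%:Z).
  have h2 := Hasse_Davenport2 m%:Z.
  have pN := gauss_sum_mulN m%:Z.
  (* The two duplications contribute 4 and 16, and g(m) g(-m) contributes -1; together they turn 1 /
     (256 t) into k = -1 / (4 t). *)
  have chiE : char_eval omega (256%:R * t)^-1 ^+ m * (chi m 4 * chi (2 * m%:Z) 4) *
    chi m (-1) = chi m k.
    have -> : char_eval omega (256%:R * t)^-1 ^+ m = chi m (256%:R * t)^-1.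
      by rewrite /mchar invr_eq0 (negPf t256).
    rewrite (mchar_mull 2) // -!mcharM; congr (mchar _ _ _).
    rewrite /k -exprnP; field; rewrite t0 F4.
    by have := t256; rewrite mulf_eq0 => /norP[-> _].
  apply: (mulIf (expf_neq0 2 G0)); rewrite [RHS]mulrDl.
  rewrite absz_nat in pN.
  have dvd : (n %| m)%N = (m == 0%N).
    by have [->|m0] := posnP m; [rewrite dvdn0|rewrite gtnNdvd // gtn_eqF].
  rewrite dvd in pN.
  set ce := char_eval omega _ ^+ m in chiE *.
  pose E := ce * (chi m 4 * chi (2 * m%:Z) 4).
  have diag : (m == 0%N)%:R * (g (- m%:Z) ^+ 3 * g (m%:Z + h) * g (2%:Z * m%:Z + h) * E) =
      - (m == 0%N)%:R * g h ^+ 2.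
    rewrite /E /ce; case: eqP => [->|_]; last by rewrite oppr0 !mul0r.
    have c0 (x : F) : x != 0 -> chi 0 x = 1 by move=> x0; rewrite -(mul0r n%:Z) mchar_muln.
    rewrite oppr0 !mulr0 add0r gauss_sum0 // !c0 // expr0; ring.
  rewrite -/E in chiE.
  transitivity ((g m%:Z * g (- m%:Z)) * (g (- m%:Z) ^+ 3 * g (m%:Z + h) * g (2%:Z *
    m%:Z + h)) * E).
    transitivity (g (2 * (2 * m%:Z)) * g h * g h * g (- m%:Z) ^+ 4 * ce).
      by rewrite m4; ring.
    rewrite -h4.
    transitivity (g (2 * m%:Z) * g h * g (2 * m%:Z + h) * chi (2 * m%:Z) 4 *
      g (- m%:Z) ^+ 4 * ce); first by ring.
    by rewrite -h2 /E; ring.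
  rewrite pN.
  transitivity (q * (g (- m%:Z) ^+ 3 * g (m%:Z + h) * g (2%:Z * m%:Z + h) * (E *
    chi m (-1)))
    - n%:R * ((m == 0%N)%:R * (g (- m%:Z) ^+ 3 * g (m%:Z + h) * g (2%:Z * m%:Z + h) *
      E))); first by ring.
  by rewrite chiE diag; field.
rewrite sum_gauss_K3 // quadratic_gauss_sum_sqr //.
have qn : q - 1 = n%:R by rewrite qE addrK.
have phiN : phi (-1) ^+ 2 = 1 by case: phiP => _ _ ->.
have phiN0 : phi (-1) != 0 by rewrite mchar_neq0.
(* The sign phi(-1) extracted here cancels the one in g(h)^2 = q phi(-1). *)
set D := \sum_a _; have -> : \sum_a \sum_b phi (a * b * (1 + a + b) * (a * b - (4 *
  t)^-1)) = phi (-1) * D.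
  rewrite /D mulr_sumr; apply: eq_bigr => a _; rewrite mulr_sumr; apply: eq_bigr => b _.
  rewrite -!mcharM; congr (mchar _ _ _); rewrite -/k; field.
  by [].
have phiV : (phi (-1))^-1 = phi (-1).
  by apply: (mulfI phiN0); rewrite mulfV // -expr2 phiN.
rewrite qn -[in RHS]phiV; field.
by rewrite phiN0 n0 q_neq0.
Qed.

End GaussSums.

(** * Good reduction *)

Section RationalReduction.

Variable K : fieldType.

(** The reduced denominator divides b. *)
Lemma denq_frac_neq0 (a b : int) : b%:~R != 0 :> K ->
  (denq (a%:~R / b%:~R))%:~R != 0 :> K.
Proof.
move=> bK; have b0 : b != 0 by apply: contraNneq bK => ->.
set x := _ / _; have E : numq x * b = a * denq x.
  apply/eqP; rewrite -(eqr_int rat) !rmorphM /= -eqr_div ?intr_eq0 ?denq_eq0 //.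
  by rewrite divq_num_den.
have /dvdzP[c bE] : (denq x %| b)%Z.
  rewrite -(Gauss_dvdzr (m := denq x) (n := numq x)); last first.
    by rewrite coprimez_sym coprimezE coprime_num_den.
  by rewrite E dvdz_mull.
by apply: contraNneq bK => d0; rewrite bE rmorphM /= d0 mulr0.
Qed.

Lemma ratr_frac (a b : int) : b%:~R != 0 :> K ->
  ratr (a%:~R / b%:~R : rat) = a%:~R / b%:~R :> K.
Proof.
move=> bK; have b0 : b != 0 by apply: contraNneq bK => ->.
have dK := denq_frac_neq0 a bK; move: dK; set x := _ / _ => dK.
have E : numq x * b = a * denq x.
  apply/eqP; rewrite -(eqr_int rat) !rmorphM /= -eqr_div ?intr_eq0 ?denq_eq0 //.
  by rewrite divq_num_den.
by apply/eqP; rewrite /ratr eqr_div // -!rmorphM /= E.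
Qed.

(** In positive characteristic [ratr] is no ring morphism, so a rational scalar is kept apart from a
    polynomial with integer coefficients. *)
Lemma map_ratr_scale (r : rat) (P : {poly int}) : (denq r)%:~R != 0 :> K ->
  map_poly (ratr : rat -> K) (r *: map_poly intr P) = ratr r *: map_poly intr P.
Proof.
move=> dK; apply/polyP => i.
rewrite coef_map_id0; last by rewrite /ratr rmorph0 mul0r.
rewrite !coefZ !coef_map /= -[r in LHS]divq_num_den mulrAC -rmorphM ratr_frac //.
by rewrite rmorphM /= mulrAC.
Qed.

End RationalReduction.

(** The surface with rho = 1 / (64 t), over any field, so that it can be compared with its
    reduction. *)
Definition Et_family (K : fieldType) (rho : K) : weierstrass K :=
  Weierstrass (4%:R^-1 *: ('X^2 - 1) ^+ 2) (rho *: ('X^2 * ('X^2 - 1) ^+ 3)).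

Lemma map_Et_family (K L : fieldType) (f : {rmorphism K -> L}) rho :
  map_weierstrass f (Et_family rho) = Et_family (f rho).
Proof.
rewrite /map_weierstrass /Et_family /= !map_polyZ /= fmorphV rmorph_nat.
by rewrite !(rmorphM, rmorphXn, rmorphB, rmorph1) /= map_polyX.
Qed.

Lemma map_ratr_Et_family (K : fieldType) (r : rat) : 2 != 0 :> K -> (denq r)%:~R != 0 :>
  K ->
  map_weierstrass (ratr : rat -> K) (Et_family r) = Et_family (ratr r).
Proof.
move=> K2 dK; have K4 : 4%:Z%:~R != 0 :> K by rewrite -pmulrn natr4_neq0.
have quarter : 4%:R^-1 = 1%:~R / 4%:Z%:~R :> rat by rewrite mul1r.
have d4 : (denq (4%:R^-1))%:~R != 0 :> K by rewrite quarter; exact: denq_frac_neq0.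
rewrite /map_weierstrass /Et_family /=.
have -> : ('X^2 - 1) ^+ 2 = map_poly intr (('X^2 - 1) ^+ 2 : {poly int}) :> {poly rat}.
  by rewrite !(rmorphM, rmorphXn, rmorphB, rmorph1) /= map_polyX.
have -> : 'X^2 * ('X^2 - 1) ^+ 3 =
  map_poly intr ('X^2 * ('X^2 - 1) ^+ 3 : {poly int}) :> {poly rat}.
  by rewrite !(rmorphM, rmorphXn, rmorphB, rmorph1) /= map_polyX.
rewrite !map_ratr_scale //.
rewrite quarter ratr_frac // mul1r.
by rewrite !(rmorphM, rmorphXn, rmorphB, rmorph1) /= map_polyX.
Qed.

(** The last factor gives the two moving fibres, at s^2 = t / (t - 1). The degree drops below 24
    exactly when 64 rho = 1 (for rho <> 0). *)
Lemma wdisc_Et_family (K : fieldType) (rho : K) : 2 != 0 :> K ->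
  wdisc (Et_family rho) = rho ^+ 2 *: ('X^4 * ('X^2 - 1) ^+ 9 *
    ((1 - 64%:R * rho) *: 'X^2 - 1)).
Proof.
move=> K2; have K4 := natr4_neq0 K2.
rewrite /wdisc /= -!mul_polyC.
have c4 : 4%:R * (4%:R^-1)%:P = 1 :> {poly K}.
  by rewrite -polyC_natr -polyCM divff // polyC1.
rewrite polyC_exp polyCB polyC1 polyCM !polyC_natr.
set c := (4%:R^-1)%:P in c4 *; set X := 'X; set r := rho%:P.
transitivity ((4%:R * c) ^+ 2 * (r * (X ^+ 2 * (X ^+ 2 - 1) ^+ 3)) ^+ 2 * (X ^+ 2 - 1) ^+ 4
   - 64%:R * r ^+ 3 * X ^+ 6 * (X ^+ 2 - 1) ^+ 9); first by ring.
by rewrite c4; ring.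
Qed.

Lemma singular_fibre_finite (L : closedFieldType) (E : weierstrass L) (a : L) :
  singular_fibre E (Some a) = root (wdisc E) a.
Proof.
rewrite /singular_fibre /form_order; have [->|D0] := eqVneq (wdisc E) 0;
  first by rewrite root0.
by rewrite -XsubC_dvd // dvdp_XsubCl.
Qed.

Lemma root_wdisc_Et_family (K : fieldType) (rho a : K) : 2 != 0 :> K -> rho != 0 ->
  root (wdisc (Et_family rho)) a =
    [|| a == 0, a ^+ 2 == 1 | (1 - 64%:R * rho) * a ^+ 2 == 1].
Proof.
move=> K2 r0; rewrite wdisc_Et_family // rootZ ?expf_neq0 // /root.
have -> : ('X^4 * ('X^2 - 1) ^+ 9 * ((1 - 64%:R * rho) *: 'X^2 - 1)).[a] =
    a ^+ 4 * (a ^+ 2 - 1) ^+ 9 * ((1 - 64%:R * rho) * a ^+ 2 - 1).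
  by rewrite !hornerE; ring.
by rewrite mulf_eq0 mulf_eq0 !expf_eq0 /= !subr_eq0 orbA.
Qed.

(** The last factor of the discriminant becomes the constant -1, which leaves 0, 1, -1 and
    infinity. *)
Lemma singular_fibres_degenerate (L : closedFieldType) (rho : L) (xs : seq (option L)) :
  2 != 0 :> L -> 64%:R * rho = 1 -> uniq xs ->
  (forall x, (x \in xs) = singular_fibre (Et_family rho) x) -> (size xs <= 4)%N.
Proof.
move=> L2 rho64 uxs xsP.
have rho0 : rho != 0.
  by apply: contra_eq_neq rho64 => ->; rewrite mulr0 eq_sym oner_neq0.
rewrite -[4%N]/(size [:: None; Some 0; Some 1; Some (-1 : L)]).
apply: (uniq_leq_size uxs) => -[a|]; last by rewrite inE.
rewrite xsP singular_fibre_finite (root_wdisc_Et_family _ L2 rho0).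
rewrite rho64 subrr mul0r [0 == 1]eq_sym oner_eq0 orbF.
rewrite -[X in _ ^+ 2 == X](expr1n _ 2) eqf_sqr !inE /=.
by case/or3P => /eqP ->; rewrite eqxx ?orbT.
Qed.

Lemma singular_fibres_generic (rho : algC) (xs : seq (option algC)) :
  rho != 0 -> 64%:R * rho != 1 ->
  (forall x, (x \in xs) = singular_fibre (Et_family rho) x) -> (5 <= size xs)%N.
Proof.
move=> rho0 rho64 xsP.
have C2 : 2 != 0 :> algC by rewrite pnatr_eq0.
have C64 : 64%:R != 0 :> algC by rewrite pnatr_eq0.
pose c := 1 - 64%:R * rho; have c0 : c != 0 by rewrite subr_eq0 eq_sym.
(* The moving fibres are at s and -s; they differ from 1 and -1 because rho <> 0. *)
pose s := sqrtC c^-1; have s2 : s ^+ 2 = c^-1 by rewrite sqrtCK.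
have s0 : s != 0 by rewrite -sqrf_eq0 s2 invr_eq0.
have s21 : s ^+ 2 != 1.
  rewrite s2 invr_eq1 /c -subr_eq0 addrAC subrr add0r oppr_eq0.
  exact: mulf_neq0.
have sing a : [|| a == 0, a ^+ 2 == 1 | a ^+ 2 == s ^+ 2] -> Some a \in xs.
  move=> Ha; rewrite xsP singular_fibre_finite (root_wdisc_Et_family _ C2 rho0) -/c.
  case/or3P: Ha => [->|->|/eqP ->]; rewrite ?orbT //.
  by rewrite s2 divff ?eqxx ?orbT.
rewrite -[5%N]/(size [:: Some 0; Some 1; Some (-1); Some s; Some (- s)]).
apply: uniq_leq_size.
  have inj (a b : algC) : (Some a == Some b) = (a == b) by [].
  have n2 (a : algC) : a != 0 -> a != - a.
    by move=> a0; rewrite -addr_eq0 -mulr2n mulrn_eq0.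
  have ns (a b : algC) : a ^+ 2 = 1 -> b ^+ 2 = s ^+ 2 -> a != b.
    by move=> a1 bs; apply: contraNneq s21 => ab; rewrite -bs -ab a1.
  have one : (1 : algC) ^+ 2 = 1 by rewrite expr1n.
  have mone : (-1 : algC) ^+ 2 = 1 by rewrite sqrrN.
  have ms : (- s) ^+ 2 = s ^+ 2 by rewrite sqrrN.
  rewrite /= !inE !inj !negb_or ![0 == _]eq_sym !oppr_eq0 !oner_eq0 s0.
  by rewrite (n2 _ (oner_neq0 _)) (n2 _ s0) !ns.
move=> x; rewrite !inE => /or4P[|||/orP[]] /eqP ->; apply: sing.
- by rewrite eqxx.
- by rewrite expr1n eqxx orbT.
- by rewrite sqrrN expr1n eqxx orbT.
- by rewrite eqxx !orbT.
- by rewrite sqrrN eqxx !orbT.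
Qed.

Lemma solve_quotient (K : fieldType) (c t a b : K) : c * t != 0 -> b != 0 ->
  a / b = (c * t)^-1 -> t = b / (a * c).
Proof.
rewrite mulf_eq0 => /norP[c0 t0] b0 /(canRL (mulfVK b0)) ->.
by field; rewrite t0 c0 b0.
Qed.

(* If t reduced to 1, the fibres at s^2 = t / (t - 1) would merge at infinity,
   leaving four singular fibres instead of five. *)
Lemma good_reduction_neq01 (F : finFieldType) (t : rat) : 2 != 0 :> F ->
  t != 0 -> t != 1 -> good_reduction F (Et t) -> ratr t != 0 :> F /\ ratr t != 1 :> F.
Proof.
move=> F2 t0 t1 [_ int4 [L [iota [ks [confC confL]]]]].
have F64 : 64%:R != 0 :> F by rewrite (natrX _ 2 6) expf_neq0.
have [r rE] : exists r : rat, r = (64%:R * t)^-1 by exists (64%:R * t)^-1.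
have EtE : Et t = Et_family r by rewrite rE.
have dr : (denq r)%:~R != 0 :> F.
  (* The leading coefficient of the quartic Weierstrass term [wa4] is r itself, so integrality makes
     its denominator invertible in F. *)
  have := int4 8%N; rewrite EtE /= coefZ.
  suff -> : ('X^2 * ('X^2 - 1) ^+ 3 : {poly rat})`_8 = 1 by rewrite mulr1.
  have -> : 'X^2 * ('X^2 - 1) ^+ 3 =
    'X^8 - 3%:R *: 'X^6 + 3%:R *: 'X^4 - 'X^2 :> {poly rat}.
    by rewrite -!mul_polyC !polyC_natr; ring.
  by rewrite !coefE /=; ring.
pose rho : F := ratr r.
rewrite EtE (map_ratr_Et_family F2 dr) in confL.
rewrite -[ratr r]/rho in confL.
rewrite map_Et_family in confL; rewrite EtE map_Et_family in confC.
have L2 : 2 != 0 :> L by rewrite -(rmorph_nat iota) fmorph_eq0.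
have [DL _ [ys [uy sy ksy]]] := confL.
have rho0 : rho != 0.
  apply: contraNneq DL => ->; apply/eqP.
  by rewrite (wdisc_Et_family _ L2) rmorph0 expr0n scale0r.
have rhoE : rho = (numq r)%:~R / (denq r)%:~R by [].
have tauE : ratr t = (64%:R * rho)^-1 :> F.
  have num0 : (numq r * 64%:Z)%:~R != 0 :> F.
    rewrite intrM mulf_neq0; [by []| |exact: F64].
    by apply: contraNneq rho0 => n0; rewrite rhoE n0 mul0r.
  have -> : t = (denq r)%:~R / (numq r * 64%:Z)%:~R.
    rewrite intrM; apply: (@solve_quotient _ _ t (numq r)%:~R);
      last by rewrite divq_num_den.
      by rewrite mulf_neq0.
    by rewrite intr_eq0 denq_eq0.
  by rewrite (ratr_frac _ num0) rhoE intrM mulrA invf_div [64%:R * _]mulrC.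
split; first by rewrite tauE invr_eq0 mulf_neq0.
apply/eqP => tau1.
have rho64 : 64%:R * rho = 1 by apply: invr_inj; rewrite -tauE tau1 invr1.
have [_ _ [xs [_ sx ksx]]] := confC.
(* Both lists of singular points have the length of the common list [ks] of fibre types. *)
have size_eq : size xs = size ys.
  by rewrite -(size_map (fibre_type (Et_family (ratr r : algC)))) -ksx ksy size_map.
have iota_rho64 : 64%:R * iota rho =
  1 by rewrite -(rmorph_nat iota 64) -rmorphM rho64 rmorph1.
have Q64 : 64%:R != 0 :> rat by rewrite pnatr_eq0.
have := singular_fibres_degenerate L2 iota_rho64 uy sy.
rewrite -size_eq leqNgt => /negP[]; apply: (singular_fibres_generic _ _ sx).
  by rewrite fmorph_eq0 rE invr_eq0 (mulf_neq0 Q64 t0).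
rewrite -(rmorph_nat (ratr : {rmorphism rat -> algC}) 64) -rmorphM fmorph_eq1 rE invfM
  mulrA.
by rewrite (divff Q64) mul1r invr_eq1.
Qed.

Theorem corollary6p7 (R : realType) (F : finFieldType)
    (psi : F -> R[i]) (omega : {unit F} -> R[i])
    (t : rat) (S : F) (sgn : bool) :
  nontrivial_additive_character psi ->
  char_generator omega ->
  coprime #|F| 6 ->
  t != 0 -> t != 1 ->
  good_reduction F (Et t) ->
  S ^+ 2 = (ratr t - 1) / ratr t ->
  7 + (-1) ^+ sgn * (9 * S) != 0 ->
  5 + (-1) ^+ sgn * (3 * S) != 0 ->
  let q : R[i] := #|F|%:R in
  let g := gauss_sum psi omega in
  q ^+ 2 * Hq psi omega (2 * (7 + (-1) ^+ sgn * (9 * S)) ^+ 2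
                           / (5 + (-1) ^+ sgn * (3 * S)) ^+ 3) ^+ 2 - q
  = - q^-1
    + (q * (q - 1))^-1 *
      \sum_(0 <= m < #|F|.-1)
        g (4%:Z * m%:Z) * g (- m%:Z) ^+ 4
        * char_eval omega (256%:R * ratr t)^-1 ^+ m.
Proof.
move=> psiP omegaP; rewrite (coprimeMr _ 2 3) => /andP[q2 q3] t0 t1 good S2.
have F2 := natr_coprime_card q2; have F3 := natr_coprime_card q3.
have F4 := natr4_neq0 F2.
have n_even : ~~ odd #|F|.-1.
  move: q2; rewrite coprimen2; have := card_finNzRing_gt1 F.
  by case: #|F| => // n _; rewrite oddS.
have [tau0 tau1] := good_reduction_neq01 F2 t0 t1 good.
set tau : F := ratr t in S2 tau0 tau1 *.
(* The choice of sign is absorbed into the square root. *)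
pose S' := (-1) ^+ sgn * S.
have S'2 : S' ^+ 2 = (tau - 1) / tau by rewrite exprMn sqrr_sign mul1r.
rewrite [_ * (9 * S)]mulrCA [_ * (3 * S)]mulrCA -/S' => S7 S5 /=.
rewrite hypergeometric_K3 // Hq_trinomial //; last first.
  by rewrite !mulf_neq0 ?invr_eq0 ?expf_neq0.
rewrite trinomial_sum_elliptic //; set z := (1 - S') / 2.
have zz : z * (1 - z) = (4 * tau)^-1.
  have -> : z * (1 - z) = (1 - S' ^+ 2) / 4 by rewrite /z; field; rewrite F2 F4.
  by rewrite S'2; field; rewrite tau0 F4.
have : z * (1 - z) != 0 by rewrite zz invr_eq0 mulf_neq0.
rewrite mulf_eq0 => /norP[z0 z1]; rewrite -zz.
rewrite elliptic_sum_Clausen //; first exact: mchar_half_quadratic.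
(* Here t <> 1 in F is used: it makes S' non-zero. *)
have -> : 2 * z - 1 = - S' by rewrite /z; field.
by rewrite oppr_eq0 -sqrf_eq0 S'2 mulf_neq0 ?invr_eq0 // subr_eq0.
Qed.
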